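(* Consider the family of two-sided queueing systems on the bipartite graph $G(N\cup M,E)$ indexed by $\eta\in\mathbb N$, operated under any pricing policy of the form $$\lambda_j(\mathbf q)=\eta\lambda_j^*+f_j\!\left(\frac{\mathbf q}{\eta^\alpha}\right)\eta^\beta\ (j\in M),\qquad \mu_i(\mathbf q)=\eta\mu_i^*+g_i\!\left(\frac{\mathbf q}{\eta^\alpha}\right)\eta^\beta\ (i\in N),$$ with $0\le\alpha\le1$ and $0<\beta<1$, that satisfies: (a) there are constants $\boldsymbol\Gamma\in\mathbb R_+^m$, $\boldsymbol\Psi\in\mathbb R_+^n$ with $|f_j(\mathbf q/\eta^\alpha)|\le\Gamma_j$ for all $j\in M$ and $|g_i(\mathbf q/\eta^\alpha)|\le\Psi_i$ for all $i\in N$, for all states $\mathbf q$ and all $\eta\ge1$; (b) $0<\alpha+\beta\le1$; (c) there are constants $\kappa,\delta>0$ such that for all $\eta$: for every $j\in M$, if $q_j^{(c)}/\eta^\alpha>\kappa$ then either $f_j(\mathbf q/\eta^\alpha)<-\delta$ or there is $i$ with $(i,j)\in E$ and $g_i(\mathbf q/\eta^\alpha)>\delta$; and for every $i\in N$, if $q_i^{(s)}/\eta^\alpha>\kappa$ then either $g_i(\mathbf q/\eta^\alpha)<-\delta$ or there is $j$ with $(i,j)\in E$ and $f_j(\mathbf q/\eta^\alpha)>\delta$. No assumption is made on the form of the matching policy. If the resulting system is stable, then there exists a constant $K=K(F,G,f,g)>0$ such that $$L^\eta\ \ge\ K\eta^{1/3}.$$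
   Context: **Model.** $N$ is a set of $n$ server types, $M$ a set of $m$ customer types, $E\subseteq N\times M$ the set of compatible pairs. The state $\mathbf q=(q^{(c)}_j,j\in M;\ q^{(s)}_i,i\in N)\in\mathbb Z_+^{m+n}$ records the numbers of waiting customers and servers of each type. In state $\mathbf q$, type-$j$ customers arrive at Poisson rate $\lambda_j(\mathbf q)\ge0$ and type-$i$ servers at Poisson rate $\mu_i(\mathbf q)\ge0$, chosen by the operator (pricing). **Matching.** A (stationary) matching policy chooses in each state $\mathbf q$ a matching $\mathbf y\in\mathbb Z_+^{nm}$ with $\sum_iy_{ij}\le q_j^{(c)}$, $\sum_jy_{ij}\le q_i^{(s)}$, $y_{ij}=0$ for $(i,j)\notin E$; with $x_j^{(c)}=\sum_iy_{ij}$, $x_i^{(s)}=\sum_jy_{ij}$, the next arrival moves the state from $\mathbf q$ to $\mathbf q+\mathbf e-\mathbf x$, where $\mathbf e$ is the unit vector of the arriving type (matched pairs leave). **Stability.** A pricing and matching policy is stable if the induced continuous-time Markov chain has a positive recurrent communicating class containing the state $\mathbf e_j^{(c)}$ (one type-$j$ customer, nothing else) for some $j\in M$. **Curves.** $F_j$ (inverse demand curve) is strictly decreasing, $G_i$ (inverse supply curve) is strictly increasing; both are nonnegative and twice continuously differentiable on the range of feasible rates, $\lambda\mapsto\lambda F_j(\lambda)$ has strictly negative second derivative, $\mu\mapsto\mu G_i(\mu)$ has strictly positive second derivative. Unit waiting costs $s_j^{(c)},s_i^{(s)}>0$ are given. **Fluid problem.** $\gamma^*=\max\sum_j\lambda_jF_j(\lambda_j)-\sum_i\mu_iG_i(\mu_i)$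 over $\boldsymbol\lambda,\boldsymbol\mu,\boldsymbol\chi$ subject to $\lambda_j=\sum_i\chi_{ij}$, $\mu_i=\sum_j\chi_{ij}$, $\chi_{ij}\ge0$ for $(i,j)\in E$ and $\chi_{ij}=0$ for $(i,j)\notin E$. $(\boldsymbol\lambda^*,\boldsymbol\mu^*,\boldsymbol\chi^* )$ denotes an optimal solution; it is assumed that $\boldsymbol\lambda^*,\boldsymbol\mu^*>0$. **Scaling.** The $\eta$-th system has the same graph and waiting costs, with curves $F^\eta_j(\eta\lambda)=F_j(\lambda)$, $G_i^\eta(\eta\mu)=G_i(\mu)$; its fluid optimum is $\eta\gamma^*$. **Profit loss.** With $\mathbb E$ the stationary expectation, $$L^\eta=\eta\gamma^*-\Big(\mathbb E\Big[\sum_j\lambda_j(\mathbf q)F_j^\eta(\lambda_j(\mathbf q))-\sum_i\mu_i(\mathbf q)G_i^\eta(\mu_i(\mathbf q))\Big]-\sum_js_j^{(c)}\mathbb E[q_j^{(c)}]-\sum_is_i^{(s)}\mathbb E[q_i^{(s)}]\Big)$$ (equal to $+\infty$ if some expected queue length is infinite). The notation $K(F,G,f,g)$ indicates a constant not depending on $\eta$. *)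

(* Defs.v *)
From HB Require Import structures.
From Stdlib Require Import Relation_Operators.
From mathcomp Require Import all_boot all_order all_algebra.
From mathcomp Require Import all_classical all_reals all_analysis.

Set Implicit Arguments.
Unset Strict Implicit.
Unset Printing Implicit Defensive.

Import Order.TTheory GRing.Theory Num.Theory.
Import numFieldNormedType.Exports.

Local Open Scope classical_set_scope.
Local Open Scope ring_scope.


Section MarkovChain.
Variables (R : realType) (S : countType).

(* Q x y is the rate of jumping from x to y; only the values at x != y
   matter. *)
Variable Q : S -> S -> R.

Definition exit_rate (x : S) : R := fine (\esum_(y in [set~ x]) (Q x y)%:E).

(* Transition probabilities of the embedded jump chain; a state with exit rate
   0 is absorbing. *)
Definition jump_prob (x y : S) : R :=
  if exit_rate x == 0 then (x == y)%:R
  else if x == y then 0 else Q x y / exit_rate x.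

Definition accessible : S -> S -> Prop :=
  clos_refl_trans S (fun x y => x != y /\ 0 < Q x y).

Definition communicating_class (C : set S) : Prop :=
  exists x, C = [set y | accessible x y /\ accessible y x].

(* taboo_prob x n y is the probability that the jump chain started at x is at y
   after n jumps without having come back to x during jumps 1, ..., n. *)
Fixpoint taboo_prob (x : S) (n : nat) : S -> \bar R :=
  match n with
  | 0%N => fun y => ((x == y)%:R)%:E
  | n'.+1 => fun z =>
      if z == x then 0%E
      else (\esum_(y in setT) (taboo_prob x n' y * (jump_prob y z)%:E)%E)
  end.

Definition return_prob (x : S) : \bar R :=
  (\sum_(0 <= n <oo)
     (\esum_(y in setT) (taboo_prob x n y * (jump_prob y x)%:E)))%E.

(* Expected duration of an excursion from x: the holding time in y has mean
   (exit_rate y)^-1. It is the mean return time to x once return_prob x = 1. *)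
Definition mean_return_time (x : S) : \bar R :=
  (\sum_(0 <= n <oo)
     (\esum_(y in setT) (taboo_prob x n y * ((exit_rate y)^-1)%:E)))%E.

Definition positive_recurrent (x : S) : Prop :=
  exit_rate x = 0 \/
  (return_prob x = 1%E /\ (mean_return_time x < +oo)%E).

Definition positive_recurrent_class (C : set S) : Prop :=
  communicating_class C /\ (forall x, C x -> positive_recurrent x).

(* pi is a stationary distribution carried by C; the last clause is the global
   balance equation pi Q = 0. *)
Definition stationary_on (C : set S) (pi : S -> R) : Prop :=
  [/\ forall x, 0 <= pi x,
      forall x, ~ C x -> pi x = 0,
      \esum_(x in setT) (pi x)%:E = 1%E
    & forall y, (pi y * exit_rate y)%:E
                = \esum_(x in [set~ y]) (pi x * Q x y)%:E ].

End MarkovChain.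

(* Expectation of h under the probability mass function pi, as the difference
   of the expectations of the positive and negative parts of h. *)
Definition expect (R : realType) (S : countType) (pi : S -> R) (h : S -> R)
  : \bar R :=
  (\esum_(x in setT) (pi x * Num.max (h x) 0)%R%:E
   - \esum_(x in setT) (pi x * Num.max (- h x) 0)%R%:E)%E.


Section Curves.
Variable R : realType.
Implicit Types (D : set R) (h : R -> R).

Definition deriv_on D h h' : Prop :=
  forall x, D x -> (fun y => (h y - h x) / (y - x)) @ within D x^' --> h' x.

Definition deriv2_on D h h'' : Prop :=
  exists h', deriv_on D h h' /\ deriv_on D h' h''.

Definition C2_on D h : Prop :=
  exists h'', deriv2_on D h h'' /\ {within D, continuous h''}.

(* The range of feasible rates of one customer or server type: any
   nondegenerate interval of nonnegative reals, e.g. [0, +oo[ or [0, b]. *)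
Definition rate_range D : Prop :=
  [/\ is_interval D, forall x, D x -> 0 <= x
    & exists x y, [/\ D x, D y & x < y]].

Definition demand_curve D h : Prop :=
  [/\ forall x, D x -> 0 <= h x,
      forall x y, D x -> D y -> x < y -> h y < h x,
      C2_on D h
    & exists r'', deriv2_on D (fun x => x * h x) r'' /\
                  forall x, D x -> r'' x < 0].

Definition supply_curve D h : Prop :=
  [/\ forall x, D x -> 0 <= h x,
      forall x y, D x -> D y -> x < y -> h x < h y,
      C2_on D h
    & exists r'', deriv2_on D (fun x => x * h x) r'' /\
                  forall x, D x -> 0 < r'' x].

(* The curve h^eta determined by h^eta (eta * x) = h x. *)
Definition scaled_curve (eta : nat) h : R -> R := fun x => h (x / eta%:R).

End Curves.


Section TwoSidedQueue.
Variables (R : realType) (N M : finType).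
Variable E : {set N * M}.

(* Types of agents: inl j is customer type j, inr i is server type i. *)
Local Notation agent := (M + N)%type.
Definition state : Type := {ffun M + N -> nat}.
HB.instance Definition _ := Countable.on state.

Definition unit_state (a : agent) : state := [ffun b => (b == a) : nat].

Definition matching : Type := {ffun N * M -> nat}.

Definition matched (y : matching) (a : agent) : nat :=
  match a with
  | inl j => (\sum_(i : N) y (i, j))%N
  | inr i => (\sum_(j : M) y (i, j))%N
  end.

Definition is_matching (q : state) (y : matching) : Prop :=
  (forall a, (matched y a <= q a)%N) /\
  (forall e, e \notin E -> y e = 0%N).

Definition matching_policy (Y : state -> matching) : Prop :=
  forall q, is_matching q (Y q).

(* q + e_a - x; no truncation occurs when Y is a matching policy. *)
Definition next_state (Y : state -> matching) (a : agent) (q : state) : state :=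
  [ffun b => (q b + unit_state a b - matched (Y q) b)%N].

(* rate a q is the arrival rate of agents of type a in state q. *)
Definition generator (rate : agent -> state -> R) (Y : state -> matching)
  (q q' : state) : R :=
  \sum_(a : agent) (if next_state Y a q == q' then rate a q else 0).

Definition stable_class (Q : state -> state -> R) (C : set state) : Prop :=
  positive_recurrent_class Q C /\ exists j : M, C (unit_state (inl j)).

Definition fluid_feasible (DF : M -> set R) (DG : N -> set R)
  (lam : M -> R) (mu : N -> R) (chi : N -> M -> R) : Prop :=
  [/\ forall j, lam j = \sum_(i : N) chi i j,
      forall i, mu i = \sum_(j : M) chi i j,
      forall i j, (i, j) \in E -> 0 <= chi i j,
      forall i j, (i, j) \notin E -> chi i j = 0
    & (forall j, DF j (lam j)) /\ (forall i, DG i (mu i))].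

Definition fluid_profit (F : M -> R -> R) (G : N -> R -> R)
  (lam : M -> R) (mu : N -> R) : R :=
  \sum_(j : M) lam j * F j (lam j) - \sum_(i : N) mu i * G i (mu i).

Definition fluid_optimal (DF : M -> set R) (DG : N -> set R)
  (F : M -> R -> R) (G : N -> R -> R)
  (lam : M -> R) (mu : N -> R) (chi : N -> M -> R) : Prop :=
  fluid_feasible DF DG lam mu chi /\
  forall lam' mu' chi', fluid_feasible DF DG lam' mu' chi' ->
    fluid_profit F G lam' mu' <= fluid_profit F G lam mu.

Definition rescaled (eta : nat) (alpha : R) (q : state) : {ffun agent -> R} :=
  [ffun a => (q a)%:R / eta%:R `^ alpha].

Definition pricing (lam : M -> R) (mu : N -> R)
  (f : M -> {ffun agent -> R} -> R) (g : N -> {ffun agent -> R} -> R)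
  (alpha beta : R) (eta : nat) (a : agent) (q : state) : R :=
  match a with
  | inl j => eta%:R * lam j + f j (rescaled eta alpha q) * eta%:R `^ beta
  | inr i => eta%:R * mu i + g i (rescaled eta alpha q) * eta%:R `^ beta
  end.

(* s is the vector of unit waiting costs, and gamma the optimal value of the
   unscaled fluid problem. The value is +oo as soon as some expected queue
   length is infinite. *)
Definition profit_loss (F : M -> R -> R) (G : N -> R -> R) (s : agent -> R)
  (gamma : R) (eta : nat) (rate : agent -> state -> R) (pi : state -> R)
  : \bar R :=
  ((eta%:R * gamma)%R%:E
   - (expect pi (fun q => fluid_profit
                   (fun j => scaled_curve eta (F j))
                   (fun i => scaled_curve eta (G i))
                   (fun j => rate (inl j) q) (fun i => rate (inr i) q))
      - \sum_(a : agent) (s a)%:E * expect pi (fun q => (q a)%:R)))%E.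

End TwoSidedQueue.

Arguments unit_state {N M} a.

(* Main.v *)
Require Import Defs.
From mathcomp Require Import all_boot all_order all_algebra.
From mathcomp Require Import all_classical all_reals all_analysis.
From mathcomp Require Import ring lra.
Set Implicit Arguments.
Unset Strict Implicit.
Unset Printing Implicit Defensive.
Import Order.TTheory GRing.Theory Num.Theory.
Import numFieldNormedType.Exports.
Local Open Scope classical_set_scope.
Local Open Scope ring_scope.

(* Write the rates as eta x*_a + d_a(q) eta^beta, let S = sum_a |d_a| and let W
   be the number of waiting customers minus that of waiting servers. Matching
   leaves W unchanged, so W is a walk with unit steps, total jump rate about
   eta and drift at most eta^beta S, whatever the matching policy. Stationarity
   applied to a Huber function of W gives, for every t >= 0,
     eta^(1-beta) P(|W| <= t) <= const (2t + 3) E[S].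
   With t = 2 E|W| + 1 this forces E|W| to be of order eta^(1-beta). With t of
   order eta^(1-beta) >= eta^alpha, either |W| <= t has large probability and
   E[S] is bounded below, or some queue exceeds kappa eta^alpha with large
   probability and condition (c) bounds S below. Since the mean rates are
   fluid feasible, the first-order term of the profit expansion at the fluid
   optimum is nonpositive in mean, and strong concavity leaves a loss of order
   eta^(2 beta - 1) E[sum_a d_a^2]. Hence the loss is at least of order
   eta^(1-beta) + eta^(2 beta - 1), which is smallest at beta = 2/3. *)

(** * Strong concavity *)

(** The punctured limit behind [deriv_on], multiplied out; at [y = x] both sides vanish. The
    estimate also holds at an endpoint of [D], where the derivative is one-sided. *)
Lemma deriv_on_expansion (R : realType) (D : set R) (h h' : R -> R) (x e : R) :
  deriv_on D h h' -> D x -> 0 < e ->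
  exists2 d, 0 < d & forall y, D y -> `|y - x| < d ->
    `|h y - h x - h' x * (y - x)| <= e * `|y - x|.
Proof.
move=> hD Dx e0; have /cvgrPdist_lt /(_ _ e0) := hD x Dx.
rewrite near_withinE => -[d /= d0 H].
exists d => // y Dy yx.
have [->|nyx] := eqVneq y x; first by rewrite !subrr mulr0 subr0 normr0 mulr0.
have nz : y - x != 0 by rewrite subr_eq0.
have := H y; rewrite /ball_ /= distrC => /(_ yx nyx Dy) /ltW.
rewrite -(ler_pM2r (_ : 0 < `|y - x|)) ?normr_gt0// -normrM.
rewrite mulrBl mulfVK //.
have -> : h y - h x - h' x * (y - x) = - (h' x * (y - x) - (h y - h x)) by ring.
by rewrite normrN.
Qed.

Lemma deriv_on_continuous (R : realType) (D A : set R) (h h' : R -> R) :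
  deriv_on D h h' -> A `<=` D -> {within A, continuous h}.
Proof.
move=> hD sD; apply/subspace_continuousP => x Ax.
apply/cvgrPdist_lt => e e0; rewrite near_withinE.
(* Slack 1 in the expansion already gives a local Lipschitz bound at [x] with constant
   [1 + |h' x|]. *)
have [d d0 H] := deriv_on_expansion hD (sD _ Ax) (@ltr01 R).
have k0 : 0 < 1 + `|h' x| by rewrite ltr_pwDl.
exists (Num.min d (e / (1 + `|h' x|))); first by rewrite /= lt_min d0 divr_gt0.
move=> y; rewrite /= lt_min distrC => /andP[yd ye] Ay.
have {}H := H _ (sD _ Ay) yd; rewrite ltr_pdivlMr // in ye.
rewrite distrC; apply: le_lt_trans ye.
rewrite mulrDr mulr1 -[X in `|X|](subrK (h' x * (y - x))).
apply: le_trans (ler_normD _ _) _; rewrite normrM [`|h' x| * _]mulrC lerD2r.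
by rewrite mul1r in H.
Qed.

(** At an interior point of [[a, b]] all small increments stay in [D], so the relative derivative is
    an ordinary one and the mean value theorem becomes available. *)
Lemma deriv_on_is_derive (R : realType) (D : set R) (h h' : R -> R) (a b z : R) :
  deriv_on D h h' -> `[a, b] `<=` D -> z \in `]a, b[ -> is_derive z 1 h (h' z).
Proof.
move=> hD sD zab.
have zD : D z by apply: sD; apply: subset_itv_oo_cc.
have cv : (fun t => t^-1 *: (h (t *: 1 + z) - h z)) @ 0^' --> h' z.
  apply/cvgrPdist_lt => e e0.
  have := hD z zD => /cvgrPdist_lt/(_ _ e0).
  rewrite near_withinE => -[d /= d0 H].
  move: (zab); rewrite in_itv /= => /andP[az zb].
  exists (Num.min d (Num.min (z - a) (b - z))) => /=.
    by rewrite !lt_min d0 !subr_gt0 az zb.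
  move=> t; rewrite /= sub0r normrN !lt_min => /andP[td /andP[ta tb]] t0.
  have := H (t + z); rewrite /= opprD addrCA subrr addr0 normrN => /(_ td).
  rewrite -subr_eq0 addrK => /(_ t0).
  rewrite -[t *: 1]/(t * 1) mulr1 -[_ *: _]/(_ * _) mulrC; apply.
  apply: sD; rewrite /= in_itv /=; move: ta tb; rewrite !lter_norml.
  by move=> /andP[? _] /andP[_ ?]; apply/andP; split; lra.
apply: DeriveDef; first by apply/cvg_ex; exists (h' z).
exact/cvg_lim.
Qed.

Lemma deriv_on_MVT (R : realType) (D : set R) (h h' : R -> R) (x y : R) :
  is_interval D -> deriv_on D h h' -> D x -> D y -> x < y ->
  exists2 z, x < z < y & h y - h x = h' z * (y - x).
Proof.
move=> iD hD Dx Dy xy.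
have sD : `[x, y] `<=` D.
  by move=> z /=; rewrite in_itv; exact: iD Dx Dy _.
have [z] := MVT xy (fun z => deriv_on_is_derive hD sD)
  (deriv_on_continuous hD sD).
by rewrite in_itv; exists z.
Qed.

Section StrongConcavity.
Variables (R : realType) (D : set R) (r r' r'' : R -> R).
Hypotheses (iD : is_interval D) (dr : deriv_on D r r')
  (dr' : deriv_on D r' r'') (r''lt0 : forall x, D x -> r'' x < 0).

Lemma deriv_decreasing x y : D x -> D y -> x <= y -> r' y <= r' x.
Proof.
move=> Dx Dy; rewrite le_eqVlt => /orP[/eqP->//|xy].
have [z /andP[xz zy] E] := deriv_on_MVT iD dr' Dx Dy xy.
have Dz : D z by apply: iD Dx Dy _ _; rewrite !ltW.
by rewrite -subr_le0 E; have := r''lt0 Dz; nra.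
Qed.

(** Near [x], half of [- r'' x] bounds the rate of decrease of [r'], the other half absorbing the
    error of the expansion. Farther away monotonicity preserves the drop already made, and the bound
    [B] on the distance turns it into a linear one with a smaller constant. *)
Lemma deriv_strictly_monotone x B : D x -> 0 < B ->
  exists2 k, 0 < k & forall y, D y -> `|y - x| <= B ->
    (r' y - r' x) * (y - x) <= - k * (y - x) ^+ 2.
Proof.
move=> Dx B0; pose k := - r'' x / 2.
have k0 : 0 < k by rewrite divr_gt0 // oppr_gt0 r''lt0.
have [d d0 H] := deriv_on_expansion dr' Dx k0.
have near_bound y : D y -> `|y - x| < d ->
    (r' y - r' x) * (y - x) <= - k * (y - x) ^+ 2.
  move=> Dy yd; have {}H := H y Dy yd.
  have E : r' y - r' x = - (2 * k) * (y - x) + (r' y - r' x - r'' x * (y - x)).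
    by rewrite /k; field.
  rewrite E mulrDl; set w := r' y - _ - _ in H *.
  have : w * (y - x) <= k * (y - x) ^+ 2.
    apply: le_trans (ler_norm _) _; rewrite normrM.
    by rewrite -[(y - x) ^+ 2]real_normK ?num_real // expr2 mulrA ler_wpM2r.
  by lra.
pose d' := d / 2.
have d'0 : 0 < d' by rewrite divr_gt0.
have d'd : d' < d by rewrite /d'; lra.
(* The second factor, [m] below, ensures [m * |y - x| <= d'] for every [y] within distance [B], so
   the drop [k * d'] dominates [k * m * |y - x|]. *)
exists (k * Num.min 1 (d' / B)).
  by rewrite mulr_gt0 // lt_min ltr01 divr_gt0.
set m := Num.min _ _; have m1 : m <= 1 by rewrite ge_min lexx.
have m0 : 0 < m by rewrite lt_min ltr01 divr_gt0.
have mB : m * B <= d' by rewrite -ler_pdivlMr // ge_min lexx orbT.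
move=> y Dy yB; have [yd|dy] := ltP `|y - x| d.
  apply: le_trans (near_bound y Dy yd) _.
  by rewrite ler_wpM2r ?sqr_ge0 // lerN2 ler_piMr // ltW.
(* beyond distance d, r' has already moved by k d' at the point x +- d' *)
have mdist : m * `|y - x| <= d' by apply: le_trans mB; rewrite ler_wpM2l // ltW.
have [xy|yx] := leP x y.
- move: dy yB mdist; rewrite ger0_norm ?subr_ge0 // => dy yB mdist.
  have Dz : D (x + d') by apply: iD Dx Dy _ _; apply/andP; split; lra.
  have nb : r' (x + d') - r' x <= - k * d'.
    rewrite -(ler_pM2r d'0) -mulrA -expr2.
    have := near_bound _ Dz; rewrite [x + d' - x]addrC addKr gtr0_norm //.
    exact.
  have dec : r' y <= r' (x + d') by apply: deriv_decreasing => //; lra.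
  have : r' y - r' x <= - (k * m) * (y - x) by nra.
  by rewrite expr2 mulrA => ?; rewrite ler_wpM2r // subr_ge0.
- move: dy yB mdist; rewrite ltr0_norm ?subr_lt0 // opprB => dy yB mdist.
  have Dz : D (x - d') by apply: iD Dy Dx _ _; apply/andP; split; lra.
  have nb : k * d' <= r' (x - d') - r' x.
    rewrite -(ler_pM2r d'0) -mulrA -expr2.
    have := near_bound _ Dz; rewrite [x - d' - x]addrC addKr normrN gtr0_norm //.
    by move=> /(_ d'd); rewrite sqrrN; lra.
  have dec : r' (x - d') <= r' y by apply: deriv_decreasing => //; lra.
  have : - (k * m) * (y - x) <= r' y - r' x by nra.
  by rewrite expr2 mulrA => ?; rewrite ler_wnM2r // subr_le0 ltW.
Qed.

(** The segment is cut at its midpoint [m] and the mean value theorem is used on each half. Going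
    right from [x], the slope is at most [r' x] on the first half and at most
    [r' m <= r' x - k * (m - x)] on the second; two half-lengths account for [k / 4]. *)
Lemma strong_concavity x B : D x -> 0 < B ->
  exists2 k, 0 < k & forall y, D y -> `|y - x| <= B ->
    r y <= r x + r' x * (y - x) - k * (y - x) ^+ 2.
Proof.
move=> Dx B0; have [k k0 H] := deriv_strictly_monotone Dx B0.
exists (k / 4); first by rewrite divr_gt0.
move=> y Dy yB; pose m := (x + y) / 2.
have [xy|yx|->] := ltgtP x y; last by rewrite subrr mulr0 expr0n mulr0 subr0 addr0.
- have Dm : D m by apply: iD Dx Dy _ _; apply/andP; rewrite /m; split; lra.
  have [xm my] : x < m /\ m < y by rewrite /m; split; lra.
  have [z1 /andP[xz1 z1m] E1] := deriv_on_MVT iD dr Dx Dm xm.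
  have [z2 /andP[mz2 z2y] E2] := deriv_on_MVT iD dr Dm Dy my.
  have Dz1 : D z1 by apply: iD Dx Dm _ _; rewrite !ltW.
  have Dz2 : D z2 by apply: iD Dm Dy _ _; rewrite !ltW.
  have r1 := deriv_decreasing Dx Dz1 (ltW xz1).
  have r2 := deriv_decreasing Dm Dz2 (ltW mz2).
  have r3 : r' m - r' x <= - k * (m - x).
    have mx : 0 < m - x by rewrite subr_gt0.
    rewrite -(ler_pM2r mx) -mulrA -expr2; apply: H => //.
    by move: yB; rewrite !gtr0_norm ?subr_gt0 //; lra.
  by rewrite /m in E1 E2 r3 *; nra.
- have Dm : D m by apply: iD Dy Dx _ _; apply/andP; rewrite /m; split; lra.
  have [mx ym] : m < x /\ y < m by rewrite /m; split; lra.
  have [z1 /andP[mz1 z1x] E1] := deriv_on_MVT iD dr Dm Dx mx.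
  have [z2 /andP[yz2 z2m] E2] := deriv_on_MVT iD dr Dy Dm ym.
  have Dz1 : D z1 by apply: iD Dm Dx _ _; rewrite !ltW.
  have Dz2 : D z2 by apply: iD Dy Dm _ _; rewrite !ltW.
  have r1 := deriv_decreasing Dz1 Dx (ltW z1x).
  have r2 := deriv_decreasing Dz2 Dm (ltW z2m).
  have r3 : - k * (m - x) <= r' m - r' x.
    have mx0 : m - x < 0 by rewrite subr_lt0.
    rewrite -(ler_nM2r mx0) -mulrA -expr2; apply: H => //.
    by move: yB; rewrite !ltr0_norm ?subr_lt0 //; lra.
  by rewrite /m in E1 E2 r3 *; nra.
Qed.

End StrongConcavity.

(** * Expectation under a probability mass function *)

Lemma esumZl (R : realType) (T : choiceType) (c : R) (a : T -> \bar R) :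
  0 <= c -> (forall x, 0 <= a x)%E ->
  (\esum_(x in setT) (c%:E * a x) = c%:E * \esum_(x in setT) a x)%E.
Proof.
move=> c0 a0; rewrite /esum -ereal_supZl //; last first.
  by apply/set0P; eexists; exists set0; [exact: fsets_set0|].
congr ereal_sup; apply/seteqP; split=> [_ [A [fA _] <-]|_ [_ [A [fA _] <-] <-]].
  exists (\sum_(x \in A) a x)%E; first by exists A; split.
  by rewrite ge0_mule_fsumr.
by exists A; [split|rewrite ge0_mule_fsumr].
Qed.

Lemma esum_delta (R : realType) (T : choiceType) (y0 : T) (c : T -> \bar R) :
  (0 <= c y0)%E -> (\esum_(y in setT) (if y0 == y then c y else 0) = c y0)%E.
Proof.
move=> c0; rewrite -(esum_set1 c0) esum_mkcond [RHS]esum_mkcond.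
apply: eq_esum => y _; rewrite in_setT.
have [<-|ny] := eqVneq y0 y; first by rewrite mem_set.
by rewrite memNset // => e; rewrite e eqxx in ny.
Qed.

Lemma esum_exchange (R : realType) (T U : choiceType) (a : T -> U -> \bar R) :
  (forall x y, 0 <= a x y)%E ->
  (\esum_(x in setT) \esum_(y in setT) a x y =
   \esum_(y in setT) \esum_(x in setT) a x y)%E.
Proof.
move=> a0; rewrite esum_esum // esum_esum //.
rewrite (@reindex_esum _ _ _ (setT `*`` fun=> setT) _
  (fun p : U * T => (p.2, p.1))) //.
split => //.
- by move=> [u v] [w z] _ _ /= [-> ->].
- by move=> [u v] _; exists (v, u).
Qed.

Section Expectation.
Variables (R : realType) (S : countType) (pi : S -> R).
Hypotheses (pi0 : forall x, 0 <= pi x) (pi1 : \esum_(x in setT) (pi x)%:E = 1%E).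

(** Meant for nonnegative [h], whose mean may be infinite; signed functions are handled by [Ex]. *)
Definition esp (h : S -> R) : \bar R := \esum_(x in setT) (pi x * h x)%:E.

Definition integ (h : S -> R) : Prop := (esp (fun x => `|h x|%R) < +oo)%E.

(* Junk unless [integ h] holds. *)
Definition Ex (h : S -> R) : R := fine (expect pi h).

Lemma esp_ge0 h : (forall x, 0 <= h x) -> (0 <= esp h)%E.
Proof. by move=> h0; apply: esum_ge0 => x _; rewrite lee_fin mulr_ge0. Qed.

Lemma le_esp h k : (forall x, h x <= k x) -> (esp h <= esp k)%E.
Proof. by move=> hk; apply: le_esum => x _; rewrite lee_fin ler_wpM2l. Qed.

Lemma eq_esp h k : h =1 k -> esp h = esp k.
Proof. by move=> hk; apply: eq_esum => x _; rewrite hk. Qed.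

Lemma espD h k : (forall x, 0 <= h x) -> (forall x, 0 <= k x) ->
  esp (fun x => h x + k x) = (esp h + esp k)%E.
Proof.
move=> h0 k0; rewrite /esp -esumD => [|x _|x _]; last 2 first.
- by rewrite lee_fin mulr_ge0.
- by rewrite lee_fin mulr_ge0.
by apply: eq_esum => x _; rewrite mulrDr.
Qed.

Lemma espZ c h : 0 <= c -> (forall x, 0 <= h x) ->
  esp (fun x => c * h x) = (c%:E * esp h)%E.
Proof.
move=> c0 h0; rewrite -esumZl // => [|x]; last by rewrite lee_fin mulr_ge0.
by apply: eq_esum => x _; rewrite mulrCA.
Qed.

Lemma esp_fin h : (forall x, 0 <= h x) -> (esp h < +oo)%E -> esp h \is a fin_num.
Proof. by move=> h0 hoo; rewrite ge0_fin_numE // esp_ge0. Qed.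

Lemma integ_le h k : (forall x, `|h x| <= k x) -> (esp k < +oo)%E -> integ h.
Proof. by move=> hk; apply: le_lt_trans; exact: le_esp. Qed.

Lemma integ_dom h k : (forall x, `|h x| <= `|k x|) -> integ k -> integ h.
Proof. exact: integ_le. Qed.

Lemma integ_esp h : (forall x, 0 <= h x) -> integ h -> (esp h < +oo)%E.
Proof. by move=> h0; rewrite /integ (eq_esp (fun x => ger0_norm (h0 x))). Qed.

Lemma integ_cst c : integ (fun=> c).
Proof.
rewrite /integ (_ : esp _ = (`|c|%:E * \esum_(x in setT) (pi x)%:E)%E).
  by rewrite pi1 mule1 ltry.
by rewrite -esumZl //; apply: eq_esum => x _; rewrite mulrC.
Qed.

Lemma integD h k : integ h -> integ k -> integ (fun x => h x + k x).
Proof.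
move=> hi ki; apply: (@integ_le _ (fun x => `|h x| + `|k x|)) => [x|].
  exact: ler_normD.
by rewrite espD // lte_add_pinfty.
Qed.

Lemma integZ c h : integ h -> integ (fun x => c * h x).
Proof.
move=> hi; apply: (@integ_le _ (fun x => `|c| * `|h x|)) => [x|].
  by rewrite normrM.
by rewrite espZ // lte_mul_pinfty ?lee_fin.
Qed.

Lemma integN h : integ h -> integ (fun x => - h x).
Proof. by rewrite /integ (eq_esp (fun x => esym (normrN (h x)))). Qed.

Lemma integB h k : integ h -> integ k -> integ (fun x => h x - k x).
Proof. by move=> hi /integN; exact: integD. Qed.

Lemma integ_bounded h c : (forall x, `|h x| <= c) -> integ h.
Proof.
move=> hc; apply: integ_dom (integ_cst c) => x.
exact: le_trans (hc x) (ler_norm c).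
Qed.

(** Any splitting of [h] into nonnegative integrable parts gives the same value: the positive part
    plus [v] equals the negative part plus [u], and all four means are finite. Linearity then needs
    no case analysis on signs. *)
Lemma expect_diff h u v : (forall x, 0 <= u x) -> (forall x, 0 <= v x) ->
  (esp u < +oo)%E -> (esp v < +oo)%E -> (forall x, h x = u x - v x) ->
  expect pi h = (esp u - esp v)%E.
Proof.
move=> u0 v0 uoo voo hE; rewrite /expect -!/(esp _).
set hp := fun x => Num.max (h x) 0; set hn := fun x => Num.max (- h x) 0.
have hp0 x : 0 <= hp x by rewrite le_max lexx orbT.
have hn0 x : 0 <= hn x by rewrite le_max lexx orbT.
have hpu x : hp x <= u x by rewrite ge_max u0 hE; have := v0 x; lra.
have hnv x : hn x <= v x by rewrite ge_max v0 hE; have := u0 x; lra.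
have hpf := esp_fin hp0 (le_lt_trans (le_esp hpu) uoo).
have hnf := esp_fin hn0 (le_lt_trans (le_esp hnv) voo).
have uf := esp_fin u0 uoo; have vf := esp_fin v0 voo.
have : (esp hp + esp v = esp hn + esp u)%E.
  rewrite -!espD //; apply: eq_esp => x; rewrite /hp /hn /Num.max.
  by have := hE x; do 2 case: ifPn; lra.
rewrite -(fineK hpf) -(fineK hnf) -(fineK uf) -(fineK vf) -!EFinD => -[] e.
by congr EFin; lra.
Qed.

Lemma Ex_diff h u v : (forall x, 0 <= u x) -> (forall x, 0 <= v x) ->
  (esp u < +oo)%E -> (esp v < +oo)%E -> (forall x, h x = u x - v x) ->
  Ex h = fine (esp u) - fine (esp v).
Proof.
move=> u0 v0 uoo voo hE; rewrite /Ex (expect_diff u0 v0 uoo voo hE) fineB //;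
  exact: esp_fin.
Qed.

Lemma integ_parts h : integ h ->
  exists u v, [/\ forall x, 0 <= u x, forall x, 0 <= v x,
    (esp u < +oo)%E, (esp v < +oo)%E & forall x, h x = u x - v x].
Proof.
move=> hi; exists (fun x => Num.max (h x) 0), (fun x => Num.max (- h x) 0).
split=> [x|x|||x].
- by rewrite le_max lexx orbT.
- by rewrite le_max lexx orbT.
- apply: le_lt_trans hi; apply: le_esp => x.
  by rewrite ge_max normr_ge0 ler_norm.
- apply: le_lt_trans hi; apply: le_esp => x.
  by rewrite ge_max normr_ge0 -normrN ler_norm.
- by rewrite /Num.max; do 2 case: ifPn; lra.
Qed.

Lemma expect_fin h : integ h -> expect pi h = (Ex h)%:E.
Proof.
move=> /integ_parts[u [v [u0 v0 uoo voo hE]]].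
rewrite (Ex_diff u0 v0 uoo voo hE) (expect_diff u0 v0 uoo voo hE) EFinB.
by rewrite !fineK // esp_fin.
Qed.

Lemma Ex_ge0E h : (forall x, 0 <= h x) -> integ h -> Ex h = fine (esp h).
Proof.
move=> h0 hi; have z : esp (fun=> 0) = 0%E.
  by apply: esum1 => x _; rewrite mulr0.
rewrite (@Ex_diff h h (fun=> 0)) ?z ?subr0 // => [|x]; last by rewrite subr0.
exact: integ_esp.
Qed.

Lemma esp_Ex h : (forall x, 0 <= h x) -> integ h -> esp h = (Ex h)%:E.
Proof. by move=> h0 hi; rewrite Ex_ge0E // fineK // esp_fin // integ_esp. Qed.

Lemma eq_Ex h k : h =1 k -> Ex h = Ex k.
Proof. by move=> /funext ->. Qed.

Lemma Ex_ge0 h : (forall x, 0 <= h x) -> integ h -> 0 <= Ex h.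
Proof. by move=> h0 hi; rewrite Ex_ge0E // fine_ge0 // esp_ge0. Qed.

Lemma ExD h k : integ h -> integ k -> Ex (fun x => h x + k x) = Ex h + Ex k.
Proof.
move=> /integ_parts[u [v [u0 v0 uoo voo hE]]].
move=> /integ_parts[w [z [w0 z0 woo zoo kE]]].
rewrite (Ex_diff u0 v0 uoo voo hE) (Ex_diff w0 z0 woo zoo kE).
rewrite (@Ex_diff _ (fun x => u x + w x) (fun x => v x + z x)).
- by rewrite !espD // !fineD ?esp_fin //; lra.
- by move=> x; rewrite addr_ge0.
- by move=> x; rewrite addr_ge0.
- by rewrite espD // lte_add_pinfty.
- by rewrite espD // lte_add_pinfty.
- by move=> x; rewrite hE kE; lra.
Qed.

Lemma ExN h : integ h -> Ex (fun x => - h x) = - Ex h.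
Proof.
move=> /integ_parts[u [v [u0 v0 uoo voo hE]]].
rewrite (Ex_diff u0 v0 uoo voo hE) (Ex_diff v0 u0 voo uoo) ?opprB // => x.
by rewrite hE opprB.
Qed.

Lemma ExZ c h : integ h -> Ex (fun x => c * h x) = c * Ex h.
Proof.
wlog c0 : c / 0 <= c => [H|] hi.
  have [/H->//|/ltW] := leP 0 c; rewrite -oppr_ge0 => c0.
  rewrite (@eq_Ex _ (fun x => - (- c * h x))) => [|x]; last by rewrite mulNr opprK.
  by rewrite ExN ?H // ?mulNr ?opprK //; exact: integZ.
move: hi => /integ_parts[u [v [u0 v0 uoo voo hE]]].
rewrite (Ex_diff u0 v0 uoo voo hE).
rewrite (@Ex_diff _ (fun x => c * u x) (fun x => c * v x)).
- by rewrite !espZ // !fineM ?esp_fin // mulrBr.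
- by move=> x; rewrite mulr_ge0.
- by move=> x; rewrite mulr_ge0.
- by rewrite espZ // lte_mul_pinfty.
- by rewrite espZ // lte_mul_pinfty.
- by move=> x; rewrite hE mulrBr.
Qed.

Lemma Ex_cst c : Ex (fun=> c) = c.
Proof.
rewrite (@eq_Ex _ (fun x => c * (fun=> 1) x)) => [|x]; last by rewrite mulr1.
rewrite ExZ; last exact: integ_cst.
rewrite Ex_ge0E //; last exact: integ_cst.
by rewrite /esp; under eq_esum do rewrite mulr1; rewrite pi1 mulr1.
Qed.

Lemma ExB h k : integ h -> integ k -> Ex (fun x => h x - k x) = Ex h - Ex k.
Proof.
move=> hi ki; rewrite ExD ?ExN //.
exact: integN.
Qed.

Lemma le_Ex h k : integ h -> integ k -> (forall x, h x <= k x) -> Ex h <= Ex k.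
Proof.
move=> hi ki hk; rewrite -subr_ge0 -ExB //; apply: Ex_ge0.
  by move=> x; rewrite subr_ge0.
exact: integB.
Qed.

Lemma integ_sum (I : finType) (h : I -> S -> R) :
  (forall i, integ (h i)) -> integ (fun x => \sum_i h i x).
Proof.
move=> hi; elim: (index_enum I) => [|i r IH].
  by under eq_fun do rewrite big_nil; exact: integ_cst.
by under eq_fun do rewrite big_cons; exact: integD.
Qed.

Lemma Ex_sum (I : finType) (h : I -> S -> R) :
  (forall i, integ (h i)) -> Ex (fun x => \sum_i h i x) = \sum_i Ex (h i).
Proof.
move=> hi; elim: (index_enum I) => [|i r IH].
  by rewrite big_nil; under eq_fun do rewrite big_nil; exact: Ex_cst.
rewrite big_cons -IH -ExD //; first by congr Ex; apply/funext => x; rewrite big_cons.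
elim: (r) => [|j s IHs].
  by under eq_fun do rewrite big_nil; exact: integ_cst.
by under eq_fun do rewrite big_cons; exact: integD.
Qed.

Lemma Ex_eq0 h : (forall x, 0 <= h x) -> integ h -> Ex h = 0 ->
  forall x, pi x * h x = 0.
Proof.
move=> h0 hi E x.
have : ((pi x * h x)%:E <= esp h)%E.
  apply: esum_ge; exists [set x]; first by split.
  by rewrite fsbig_set1.
rewrite esp_Ex // E lee_fin => le0.
by apply/eqP; rewrite eq_le le0 mulr_ge0.
Qed.

(** If [h] stayed strictly on one side of its mean, a positive function would have mean zero and
    [pi] would vanish. So the mean lies between two values of [h], which suffices even when [D] is
    not closed. *)
Lemma Ex_in_interval (D : set R) h : is_interval D -> (forall x, D (h x)) ->
  integ h -> D (Ex h).
Proof.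
move=> iD Dh hi; set m := Ex h.
have mi : integ (fun x => h x - m) by apply: integB => //; exact: integ_cst.
have E0 : Ex (fun x => h x - m) = 0.
  by rewrite ExB ?Ex_cst ?subrr //; exact: integ_cst.
have not0 : ~ forall x, pi x = 0.
  move=> H; move: pi1; rewrite esum1 => [/eqP|x _]; last by rewrite H.
  by rewrite eqe eq_sym oner_eq0.
have [[x hx]|nx] := pselect (exists x, h x <= m); last first.
  exfalso; apply: not0 => x.
  have gt0 z : 0 < h z - m.
    by rewrite subr_gt0 ltNge; apply/negP => hz; apply: nx; exists z.
  have /eqP := Ex_eq0 (fun z => ltW (gt0 z)) mi E0 x.
  by rewrite mulf_eq0 (gt_eqF (gt0 x)) orbF => /eqP.
have [[y hy]|ny] := pselect (exists y, m <= h y); last first.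
  exfalso; apply: not0 => y.
  have gt0 z : 0 < - (h z - m).
    by rewrite oppr_gt0 subr_lt0 ltNge; apply/negP => hz; apply: ny; exists z.
  have mi' : integ (fun z => - (h z - m)).
    exact: integN.
  have E0' : Ex (fun z => - (h z - m)) = 0 by rewrite ExN // E0 oppr0.
  have /eqP := Ex_eq0 (fun z => ltW (gt0 z)) mi' E0' y.
  by rewrite mulf_eq0 (gt_eqF (gt0 y)) orbF => /eqP.
by apply: iD (Dh x) (Dh y) _ _; rewrite hx.
Qed.
End Expectation.

(** * Stationarity *)

Lemma esum_setD1 (R : realType) (T : choiceType) (x : T) (a : T -> \bar R) :
  (forall y, 0 <= a y)%E ->
  (\esum_(y in setT) a y = a x + \esum_(y in [set~ x]) a y)%E.
Proof.
move=> a0; rewrite (esumID [set x]) => [|y _]; last exact: a0.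
by rewrite !setTI esum_set1.
Qed.

Section Stationarity.
Variables (R : realType) (N M : finType).
Variable rate : M + N -> state N M -> R.
Variable Y : state N M -> matching N M.
Variables (C : set (state N M)) (pi : state N M -> R).
Hypothesis rate0 : forall a q, 0 <= rate a q.
Local Notation Q := (generator rate Y).
Hypothesis st : stationary_on Q C pi.

Let pi0 q : 0 <= pi q. Proof. by case: st. Qed.

Lemma generator_ge0 x y : 0 <= Q x y.
Proof. by apply: sumr_ge0 => a _; case: ifP. Qed.

(** The diagonal [Q x x] is included: [Y] is arbitrary here, so an arrival may leave the state
    unchanged. *)
Lemma esum_generator (phi : state N M -> R) x : (forall y, 0 <= phi y) ->
  \esum_(y in setT) (Q x y * phi y)%:E =
  (\sum_a rate a x * phi (next_state Y a x))%:E.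
Proof.
move=> phi0.
transitivity (\esum_(y in setT) \sum_a
    (if next_state Y a x == y then (rate a x * phi y)%:E else 0%E))%E.
  apply: eq_esum => y _; rewrite mulr_suml -sumEFin; apply: eq_bigr => a _.
  by case: ifP => //; rewrite mul0r.
rewrite esum_sum => [|y a _ _]; last by case: ifP; rewrite // lee_fin mulr_ge0.
rewrite -sumEFin; apply: eq_bigr => a _.
by rewrite (@esum_delta _ _ _ (fun y => (rate a x * phi y)%:E)) // lee_fin mulr_ge0.
Qed.

Lemma exit_rateE x : exit_rate Q x = \sum_a rate a x - Q x x.
Proof.
have := esum_generator x (fun=> @ler01 R).
rewrite (esum_setD1 x) => [|y]; last by rewrite mulr1 lee_fin generator_ge0.
under eq_esum do rewrite mulr1; under eq_bigr do rewrite mulr1.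
rewrite mulr1 /exit_rate; case: (\esum_(y in _) _)%E => [z| |] //= [<-].
by rewrite addrC addrK.
Qed.

(** Adding [pi y * Q y y] to both sides of global balance turns the exit rate into the total arrival
    rate and removes the exclusion of the diagonal. *)
Lemma full_balance y :
  (pi y * \sum_a rate a y)%:E = \esum_(x in setT) (pi x * Q x y)%:E.
Proof.
rewrite (esum_setD1 y) => [|x]; last by rewrite lee_fin mulr_ge0 ?generator_ge0.
case: st => _ _ _ <-; rewrite exit_rateE -EFinD; congr EFin; ring.
Qed.

(** The generator applied to [phi] has stationary mean zero, written without subtraction so that it
    holds in the extended reals for unbounded [phi]. Full balance is weighted by [phi] and the
    nonnegative double sum exchanged. *)
Lemma stationary_identity (phi : state N M -> R) : (forall q, 0 <= phi q) ->
  esp pi (fun q => (\sum_a rate a q) * phi q) =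
  esp pi (fun q => \sum_a rate a q * phi (next_state Y a q)).
Proof.
move=> phi0.
transitivity (\esum_(y in setT) \esum_(x in setT)
    ((phi y)%:E * (pi x * Q x y)%:E))%E.
  apply: eq_esum => y _.
  rewrite esumZl // => [|x]; last by rewrite lee_fin mulr_ge0 ?generator_ge0.
  by rewrite -full_balance -EFinM; congr EFin; ring.
rewrite esum_exchange => [|x y]; last first.
  by rewrite -EFinM lee_fin !mulr_ge0 ?generator_ge0.
apply: eq_esum => x _; rewrite EFinM -esum_generator // -esumZl // => [|y]; last first.
  by rewrite lee_fin mulr_ge0 ?generator_ge0.
by apply: eq_esum => y _; rewrite -!EFinM; congr EFin; ring.
Qed.

End Stationarity.

(** * The Huber function *)

Section Huber.
Variables (R : realType) (T : R).

Definition clip (w : R) : R := Num.max (- T) (Num.min w T).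

(* Equals w^2 on [-T, T], with linear growth outside: the maximum over
   |u| <= T of 2uw - u^2, attained at u = clip w. *)
Definition huber (w : R) : R := 2 * clip w * w - clip w ^+ 2.

Lemma clip_cases (T0 : 0 <= T) w : [\/ clip w = - T /\ w <= - T,
  [/\ clip w = w, - T <= w & w <= T] | clip w = T /\ T <= w].
Proof.
have NT : - T <= T by lra.
rewrite /clip; have [wT|Tw] := leP w T; last first.
  by constructor 3; split; [rewrite max_r|exact: ltW].
have [Nw|wN] := leP (- T) w; first by constructor 2.
by constructor 1; split => //; exact: ltW.
Qed.

Lemma clip_bound (T0 : 0 <= T) w : `|clip w| <= T.
Proof.
by rewrite ler_norml; case: (clip_cases T0 w) => [[-> ?]|[-> ? ?]|[-> ?]];
  apply/andP; split; lra.
Qed.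

Lemma huber_max (T0 : 0 <= T) u w : `|u| <= T -> 2 * u * w - u ^+ 2 <= huber w.
Proof.
rewrite /huber ler_norml => /andP[Tu uT].
case: (clip_cases T0 w) => [[-> wT]|[-> ? ?]|[-> Tw]].
- have : 0 <= (u - - T) * (- T - w) by rewrite mulr_ge0 ?subr_ge0.
  by have := sqr_ge0 (u + T); lra.
- by have := sqr_ge0 (u - w); lra.
- have : 0 <= (T - u) * (w - T) by rewrite mulr_ge0 ?subr_ge0.
  by have := sqr_ge0 (u - T); lra.
Qed.

Lemma huber_ge0 (T0 : 0 <= T) w : 0 <= huber w.
Proof.
by have := huber_max (u := 0) T0 w; rewrite normr0 mulr0 mul0r expr0n subr0; exact.
Qed.

Lemma huber_le (T0 : 0 <= T) w : huber w <= 2 * T * `|w|.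
Proof.
have := clip_bound T0 w; set u := clip w => uT.
apply: (@le_trans _ _ (2 * u * w)); first by rewrite gerBl sqr_ge0.
apply: le_trans (ler_norm _) _; rewrite !normrM ger0_norm //.
by rewrite ler_wpM2r // ler_wpM2l.
Qed.

(** Keeping the maximizer [clip w] as competitor at [w + e] gives the linear term. When
    [|w| <= T - 1] both points lie in the quadratic zone, and the competitor [w + e] gains the extra
    [e ^+ 2 = 1]. *)
Lemma huber_step (T0 : 0 <= T) w (e : R) : e = 1 \/ e = - 1 ->
  huber w + 2 * clip w * e + (`|w| <= T - 1)%R%:R <= huber (w + e).
Proof.
move=> he; have [wT|_] := leP `|w| (T - 1); last first.
  rewrite addr0; apply: le_trans (huber_max T0 _ (clip_bound T0 w)).
  by rewrite /huber; lra.
move: wT; rewrite ler_norml => /andP[w1 w2].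
have cw : clip w = w.
  by case: (clip_cases T0 w) => [[-> ?]|[-> ? ?]|[-> ?]]; lra.
have -> : huber w = w ^+ 2 by rewrite /huber cw; ring.
have wT : `|w + e| <= T by rewrite ler_norml; case: he => ->; apply/andP; split; lra.
apply: le_trans (huber_max T0 _ wT); rewrite cw.
by case: he => ->; rewrite /=; nra.
Qed.
End Huber.

(** * Optimality in the fluid problem *)

(** The inverse of one plus the sum of the inverses lies below every [d a], and is positive even
    when [A] is empty. *)
Lemma finite_positive_bound (R : realType) (A : finType) (P : A -> R -> Prop) :
  (forall a x y, 0 < y -> y <= x -> P a x -> P a y) ->
  (forall a, exists2 x, 0 < x & P a x) -> exists2 m, 0 < m & forall a, P a m.
Proof.
move=> dP /(_ _)/cid2 eP.
pose d a := s2val (eP a).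
have d0 a : 0 < d a by exact: s2valP (eP a).
have ge a : (d a)^-1 <= 1 + \sum_b (d b)^-1.
  rewrite (bigD1 a) //= addrCA lerDl addr_ge0 // sumr_ge0 // => b _.
  by rewrite invr_ge0 ltW.
have s0 : 0 < 1 + \sum_b (d b)^-1.
  by rewrite ltr_pwDl // sumr_ge0 // => b _; rewrite invr_ge0 ltW.
exists (1 + \sum_b (d b)^-1)^-1; first by rewrite invr_gt0.
move=> a; apply: (dP a (d a)); last exact: s2valP' (eP a).
  by rewrite invr_gt0.
by rewrite -[leRHS]invrK lef_pV2 ?posrE ?invr_gt0.
Qed.

Lemma deriv_onN (R : realType) (D : set R) (h h' : R -> R) :
  deriv_on D h h' -> deriv_on D (fun x => - h x) (fun x => - h' x).
Proof.
move=> hD x Dx; apply: cvg_trans (cvgN (hD x Dx)).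
apply: near_eq_cvg; near=> y => /=.
by rewrite -mulNr opprB opprK addrC.
Unshelve. all: by end_near.
Qed.

Section Fluid.
Variables (R : realType) (N M : finType) (E : {set N * M}).
Variables (DF : M -> set R) (DG : N -> set R) (F : M -> R -> R) (G : N -> R -> R).
Hypotheses (hDF : forall j, rate_range (DF j)) (hDG : forall i, rate_range (DG i)).
Hypotheses (hF : forall j, demand_curve (DF j) (F j)).
Hypotheses (hG : forall i, supply_curve (DG i) (G i)).

Definition pack (T : Type) (u : M -> T) (v : N -> T) (a : M + N) : T :=
  match a with inl j => u j | inr i => v i end.

(** The sign makes the supply terms concave too, so customers and servers are treated alike. *)
Definition gain (a : M + N) (x : R) : R :=
  match a with inl j => x * F j x | inr i => - (x * G i x) end.

Lemma fluid_profitE lam mu :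
  fluid_profit F G lam mu = \sum_a gain a (pack lam mu a).
Proof. by rewrite big_sumType /= sumrN. Qed.

Lemma gain_deriv a : exists r' r'', [/\ deriv_on (pack DF DG a) (gain a) r',
  deriv_on (pack DF DG a) r' r'' & forall x, pack DF DG a x -> r'' x < 0].
Proof.
case: a => [j|i] /=.
  by have [_ _ _ [r'' [[r' [? ?]] ?]]] := hF j; exists r', r''.
have [_ _ _ [r'' [[r' [? ?]] H]]] := hG i.
exists (fun x => - r' x), (fun x => - r'' x); split; try exact: deriv_onN.
by move=> x /H; rewrite oppr_lt0.
Qed.

Lemma range_interval a : is_interval (pack DF DG a).
Proof. by case: a => [j|i]; [case: (hDF j)|case: (hDG i)]. Qed.

Lemma feasible_segment lam mu chi lam' mu' chi' t : 0 <= t <= 1 ->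
  fluid_feasible E DF DG lam mu chi -> fluid_feasible E DF DG lam' mu' chi' ->
  fluid_feasible E DF DG (fun j => lam j + t * (lam' j - lam j))
    (fun i => mu i + t * (mu' i - mu i))
    (fun i j => chi i j + t * (chi' i j - chi i j)).
Proof.
move=> /andP[t0 t1] [l m c e [dl dm]] [l' m' c' e' [dl' dm']]; split.
- by move=> j; rewrite big_split /= -mulr_sumr sumrB -l -l'.
- by move=> i; rewrite big_split /= -mulr_sumr sumrB -m -m'.
- by move=> i j Eij; have := c i j Eij; have := c' i j Eij; nra.
- by move=> i j Eij; rewrite e // e' // subrr mulr0 addr0.
- have seg (D : set R) x y : is_interval D -> D x -> D y -> D (x + t * (y - x)).
    move=> iD Dx Dy; have [xy|yx] := leP x y.
      by apply: iD Dx Dy _ _; apply/andP; nra.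
    by apply: iD Dy Dx _ _; apply/andP; nra.
  split=> [j|i]; apply: seg => //.
    exact: range_interval (inl j).
  exact: range_interval (inr i).
Qed.

Variables (lam : M -> R) (mu : N -> R) (chi : N -> M -> R).
Hypothesis hopt : fluid_optimal E DF DG F G lam mu chi.
Local Notation xs := (pack lam mu).

Lemma optimal_in_range a : pack DF DG a (xs a).
Proof. by case: hopt => -[_ _ _ _ [? ?]] _; case: a. Qed.

(** A short step from the optimum towards a feasible point stays feasible, so a positive directional
    derivative [L] would increase the profit. *)
Lemma first_order_condition (r' : M + N -> R -> R) lam' mu' chi' :
  (forall a, deriv_on (pack DF DG a) (gain a) (r' a)) ->
  fluid_feasible E DF DG lam' mu' chi' ->
  \sum_a r' a (xs a) * (pack lam' mu' a - xs a) <= 0.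
Proof.
move=> dr feas'; have [feas opt] := hopt.
set x' := pack lam' mu'; set L := \sum_a _; rewrite leNgt; apply/negP => L0.
pose S := \sum_a `|x' a - xs a|; have S0 : 0 <= S by exact: sumr_ge0.
(* With this slack the first-order gain exceeds the error: [L - e * S = e > 0]. *)
pose e := L / (S + 1).
have e0 : 0 < e by rewrite divr_gt0 // ltr_wpDl.
have [m m0 Hm] : exists2 m, 0 < m & forall a y, pack DF DG a y ->
    `|y - xs a| <= m * `|x' a - xs a| ->
    `|gain a y - gain a (xs a) - r' a (xs a) * (y - xs a)| <= e * `|y - xs a|.
  apply: finite_positive_bound => [a u v v0 vu H y Dy yv|a].
    by apply: H => //; apply: le_trans yv _; rewrite ler_wpM2r.
  have [d d0 H] := deriv_on_expansion (dr a) (optimal_in_range a) e0.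
  exists (d / (`|x' a - xs a| + 1)); first by rewrite divr_gt0 // ltr_wpDl.
  move=> y Dy yd; apply: H => //; apply: le_lt_trans yd _.
  by rewrite mulrAC ltr_pdivrMr ?ltr_wpDl // ltr_pM2l // ltrDl.
pose t := Num.min 1 m.
have t0 : 0 < t by rewrite lt_min ltr01.
have t1 : t <= 1 by rewrite ge_min lexx.
have tm : t <= m by rewrite ge_min lexx orbT.
have step a : t * (r' a (xs a) * (x' a - xs a)) - e * (t * `|x' a - xs a|) <=
    gain a (xs a + t * (x' a - xs a)) - gain a (xs a).
  have Dy : pack DF DG a (xs a + t * (x' a - xs a)).
    have [|_ _ _ _ [Dl Dm]] := feasible_segment (t := t) _ feas feas'.
      by rewrite ltW.
    by case: (a) => [j|i]; [exact: Dl|exact: Dm].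
  have := Hm a _ Dy.
  rewrite [_ + _ - xs a]addrC addKr normrM (gtr0_norm t0) ler_wpM2r // => /(_ isT).
  by rewrite ler_norml => /andP[+ _]; lra.
have t01 : 0 <= t <= 1 by rewrite ltW.
have := opt _ _ _ (feasible_segment t01 feas feas').
rewrite !fluid_profitE -subr_le0 -sumrB.
have : \sum_a (t * (r' a (xs a) * (x' a - xs a)) - e * (t * `|x' a - xs a|)) <=
    \sum_a (gain a (xs a + t * (x' a - xs a)) - gain a (xs a)).
  by apply: ler_sum => a _; exact: step.
have -> : \sum_a (t * (r' a (xs a) * (x' a - xs a)) - e * (t * `|x' a - xs a|))
    = t * L - e * (t * S) by rewrite sumrB /L /S !mulr_sumr.
move=> H1 H2.
have {H2}H2 : \sum_a (gain a (xs a + t * (x' a - xs a)) - gain a (xs a)) <= 0.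
  by apply: le_trans H2; rewrite le_eqVlt; apply/orP; left; apply/eqP;
    apply: eq_bigr => -[].
have : e * (S + 1) = L by rewrite mulfVK // gt_eqF // ltr_wpDl.
by nra.
Qed.

(** Strong concavity of each [gain] at the optimum, summed, with one [k] for all types. Both [r']
    and [k] are fixed before any [eta] appears, which keeps the final constant uniform. *)
Lemma quadratic_gap B : 0 < B -> exists r' k, [/\ 0 < k,
  forall a, deriv_on (pack DF DG a) (gain a) (r' a) &
  forall x : M + N -> R, (forall a, pack DF DG a (x a)) ->
    (forall a, `|x a - xs a| <= B) ->
    \sum_a gain a (x a) <= fluid_profit F G lam mu
      + \sum_a r' a (xs a) * (x a - xs a) - k * \sum_a (x a - xs a) ^+ 2].
Proof.
move=> B0; have /choice[r' hr'] := gain_deriv.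
have [k k0 Hk] : exists2 k, 0 < k & forall a, forall y, pack DF DG a y ->
    `|y - xs a| <= B ->
    gain a y <= gain a (xs a) + r' a (xs a) * (y - xs a) - k * (y - xs a) ^+ 2.
  apply: finite_positive_bound => [a x y y0 yx H z Dz zB|a].
    apply: le_trans (H z Dz zB) _.
    by rewrite lerD2l lerN2 ler_wpM2r ?sqr_ge0.
  have [r'' [d1 d2 neg]] := hr' a.
  exact: (strong_concavity (@range_interval a) d1 d2 neg (optimal_in_range a) B0).
exists r', k; split => // [a|x Dx xB]; first by have [r'' []] := hr' a.
rewrite fluid_profitE mulr_sumr -big_split -sumrB /=.
by apply: ler_sum => a _; exact: Hk.
Qed.
End Fluid.

(** * Flow balance and the imbalance walk *)

Section Queue.
Variables (R : realType) (N M : finType) (E : {set N * M}).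
Variable Y : state N M -> matching N M.
Hypothesis hY : matching_policy E Y.

Definition side (a : M + N) : R := match a with inl _ => 1 | inr _ => - 1 end.

Definition imbalance (q : state N M) : R := \sum_a side a * (q a)%:R.

Lemma side_cases a : side a = 1 \/ side a = - 1.
Proof. by case: a; [left|right]. Qed.

(** For a matching policy the truncated subtraction in [next_state] is exact. *)
Lemma next_stateE a b q :
  (next_state Y a q b)%:R = (q b)%:R + (b == a)%:R - (matched (Y q) b)%:R :> R.
Proof.
have [/(_ b) le_b _] := hY q.
by rewrite ffunE natrB ?natrD ?ffunE // (leq_trans le_b) ?leq_addr.
Qed.

(* every match removes one customer and one server *)
Lemma matched_balance (y : matching N M) : \sum_a side a * (matched y a)%:R = 0.
Proof.
rewrite big_sumType /=; under eq_bigr do rewrite mul1r natr_sum.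
under [X in _ + X]eq_bigr do rewrite mulN1r natr_sum.
by rewrite sumrN exchange_big subrr.
Qed.

Lemma imbalance_next a q : imbalance (next_state Y a q) = imbalance q + side a.
Proof.
rewrite /imbalance; under eq_bigr do rewrite next_stateE mulrBr mulrDr.
rewrite sumrB big_split /= matched_balance subr0; congr (_ + _).
rewrite (bigD1 a) //= eqxx mulr1 big1 ?addr0 // => b /negbTE ->.
by rewrite mulr0.
Qed.

Lemma imbalance_le q : `|imbalance q| <= \sum_a (q a)%:R.
Proof.
apply: le_trans (ler_norm_sum _ _ _) _; apply: ler_sum => a _.
by rewrite normrM normr_nat; case: a => a; rewrite /= ?normrN normr1 mul1r.
Qed.

Variables (C : set (state N M)) (pi : state N M -> R).
Variable rate : M + N -> state N M -> R.
Hypothesis rate0 : forall a q, 0 <= rate a q.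
Hypothesis st : stationary_on (generator rate Y) C pi.
Variable Lmax : R.
Hypothesis rate_le : forall q, \sum_a rate a q <= Lmax.
Hypothesis hq : forall a, integ pi (fun q => (q a)%:R).

Let pi0 q : 0 <= pi q. Proof. by case: st. Qed.
Let pi1 : \esum_(q in setT) (pi q)%:E = 1%E. Proof. by case: st. Qed.

Let total0 q : 0 <= \sum_a rate a q. Proof. exact: sumr_ge0. Qed.

Lemma integ_total phi : integ pi phi ->
  integ pi (fun q => (\sum_a rate a q) * phi q).
Proof.
move=> /(integZ pi0 Lmax); apply: integ_dom => // q; rewrite !normrM.
by rewrite ler_wpM2r // ger0_norm // (le_trans (rate_le q)) // ler_norm.
Qed.

Lemma integ_rate a : integ pi (rate a).
Proof.
apply: (@integ_bounded _ _ _ pi0 pi1 _ Lmax) => q; rewrite ger0_norm //.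
by apply: le_trans (rate_le q); rewrite (bigD1 a) //= lerDl sumr_ge0.
Qed.

(** Integrability after the jump is inferred from the identity in the extended reals: its other side
    is finite because the total rate is bounded. *)
Lemma stationary_Ex phi : (forall q, 0 <= phi q) -> integ pi phi ->
  integ pi (fun q => \sum_a rate a q * phi (next_state Y a q)) /\
  Ex pi (fun q => (\sum_a rate a q) * phi q) =
  Ex pi (fun q => \sum_a rate a q * phi (next_state Y a q)).
Proof.
move=> phi0 phii; have id := stationary_identity rate0 st phi0.
have lhs0 q : 0 <= (\sum_a rate a q) * phi q by rewrite mulr_ge0.
have rhs0 q : 0 <= \sum_a rate a q * phi (next_state Y a q).
  by apply: sumr_ge0 => a _; rewrite mulr_ge0.
have li := integ_total phii.
have ri : integ pi (fun q => \sum_a rate a q * phi (next_state Y a q)).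
  rewrite /integ (eq_esp _ (fun q => ger0_norm (rhs0 q))).
  by apply: le_lt_trans (integ_esp lhs0 li); rewrite id.
by split => //; rewrite (Ex_ge0E pi0 lhs0 li) (Ex_ge0E pi0 rhs0 ri) id.
Qed.

Lemma integ_matched b :
  integ pi (fun q => (\sum_a rate a q) * (matched (Y q) b)%:R).
Proof.
apply: integ_total; apply: integ_dom (hq b) => // q.
by rewrite !normr_nat ler_nat; case: (hY q).
Qed.

(** Stationarity for the test function [q b]: its mean increase by arrivals equals its mean decrease
    by matches. *)
Lemma flow_balance b :
  Ex pi (fun q => (\sum_a rate a q) * (matched (Y q) b)%:R) = Ex pi (rate b).
Proof.
have [_] := stationary_Ex (fun q => ler0n R (q b)) (hq b).
have E1 q : \sum_a rate a q * (next_state Y a q b)%:R =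
    ((\sum_a rate a q) * (q b)%:R + rate b q)
    - (\sum_a rate a q) * (matched (Y q) b)%:R.
  under eq_bigr do rewrite next_stateE mulrBr mulrDr.
  rewrite sumrB big_split /= -!mulr_suml; congr (_ + _ - _).
  rewrite (bigD1 b) //= eqxx mulr1 big1 ?addr0 // => a /negbTE.
  by rewrite eq_sym => ->; rewrite mulr0.
have Li := integ_total (hq b); have Ri := integ_rate b.
rewrite (eq_Ex pi E1) (ExB pi0 (integD pi0 Li Ri) (integ_matched b)).
by rewrite (ExD pi0 Li Ri); lra.
Qed.

Lemma integ_imbalance : integ pi imbalance.
Proof.
apply: integ_dom (integ_sum pi0 pi1 hq) => // q.
exact: le_trans (imbalance_le q) (ler_norm _).
Qed.

(** In the application [c] is [eta] times the sum of the fluid rates, and [sigma] is eta^beta times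
    the sum of the [|d a q|]. *)
Variables (c : R) (sigma : state N M -> R).
Hypothesis sigma0 : forall q, 0 <= sigma q.
Hypothesis sigmai : integ pi sigma.
Hypothesis drift_le : forall q, `|\sum_a side a * rate a q| <= sigma q.
Hypothesis total_ge : forall q, c - sigma q <= \sum_a rate a q.

Lemma integ_indicator (P : state N M -> bool) : integ pi (fun q => (P q)%:R).
Proof.
apply: (@integ_bounded _ _ _ pi0 pi1 _ 1) => q.
by rewrite normr_nat; case: (P q).
Qed.

(* Test function huber T (imbalance q): its drift term is at most 2 T sigma,
   and each arrival contributes at least 1 when |imbalance| <= T - 1. *)
Lemma imbalance_spread (t : R) : 0 <= t ->
  c * Ex pi (fun q => (`|imbalance q| <= t)%R%:R) <= (2 * t + 3) * Ex pi sigma.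
Proof.
(* One more than [t], so that the unit gain in [huber_step] occurs exactly when
   [|imbalance q| <= t]. *)
move=> t0; pose T := t + 1; have T0 : 0 <= T by rewrite addr_ge0.
have tT : t = T - 1 by rewrite /T addrK.
pose phi q := huber T (imbalance q).
have phi0 q : 0 <= phi q by exact: huber_ge0.
have phii : integ pi phi.
  have := integZ pi0 (2 * T) integ_imbalance; apply: integ_dom => // q.
  rewrite ger0_norm // normrM [`|2 * T|]ger0_norm ?mulr_ge0 //.
  exact: huber_le.
have [ri id] := stationary_Ex phi0 phii.
have li := integ_total phii.
have ii := integ_indicator (fun q => `|imbalance q| <= t).
(* Here [2 * t + 3] is [2 * T + 1]: [2 * T] pays for the clipped drift, and 1 for the shortfall of
   the total rate below [c]. *)
have pw q : (\sum_a rate a q) * phi q + c * (`|imbalance q| <= t)%R%:R <=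
    \sum_a rate a q * phi (next_state Y a q) + (2 * t + 3) * sigma q.
  set w := imbalance q; set u := clip T w; set i := (`|w| <= t)%R%:R.
  have : \sum_a rate a q * (phi q + 2 * u * side a + i) <=
      \sum_a rate a q * phi (next_state Y a q).
    apply: ler_sum => a _; rewrite ler_wpM2l // /phi imbalance_next.
    by rewrite /i tT; exact: huber_step T0 _ _ (side_cases a).
  have -> : \sum_a rate a q * (phi q + 2 * u * side a + i) =
      (\sum_a rate a q) * phi q + 2 * (u * \sum_a side a * rate a q)
      + (\sum_a rate a q) * i.
    rewrite !mulr_suml !mulr_sumr -!big_split /=.
    by apply: eq_bigr => a _; ring.
  have uT := clip_bound T0 w.
  have : `|u * \sum_a side a * rate a q| <= T * sigma q.
    by rewrite normrM ler_pM // drift_le.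
  rewrite ler_norml => /andP[lo _].
  have i0 : 0 <= i by exact: ler0n.
  have i1 : i <= 1 by rewrite /i lern1 leq_b1.
  have : (c - sigma q) * i <= (\sum_a rate a q) * i.
    by rewrite ler_wpM2r.
  have : sigma q * i <= sigma q by rewrite ler_piMr.
  by rewrite /T in lo; lra.
have ci := integZ pi0 c ii; have si := integZ pi0 (2 * t + 3) sigmai.
have := le_Ex pi0 (integD pi0 li ci) (integD pi0 ri si) pw.
by rewrite (ExD pi0 li ci) (ExD pi0 ri si) id lerD2l (ExZ pi0 _ ii) (ExZ pi0 _ sigmai).
Qed.
End Queue.

(** * Profit loss *)

(** For [beta >= 2/3] the second term alone suffices. For smaller [beta] the exponent [1 - beta]
    exceeds 1/3, so [X] is large enough, except for bounded [n], where the second term is bounded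
    below. *)
Lemma powR_tradeoff (R : realType) (a b c beta : R) :
  0 < a -> 0 < b -> 0 < c -> 0 < beta < 1 -> exists2 K, 0 < K &
  forall (n : nat) (X : R), (1 <= n)%N -> 0 <= X ->
    c * n%:R `^ (1 - beta) <= 4 * X + 5 ->
    K * n%:R `^ (3%:R^-1) <= a * X + b * n%:R `^ (2 * beta - 1).
Proof.
move=> a0 b0 c0 /andP[beta0 beta1].
pose K := Num.min b (Num.min (a * c / 8) (b * (c / 10) ^+ 4)).
have K0 : 0 < K by rewrite !lt_min b0 !mulr_gt0 ?exprn_gt0 ?divr_gt0.
have [Kb [Kac Kbc]] : K <= b /\ K <= a * c / 8 /\ K <= b * (c / 10) ^+ 4.
  by rewrite /K !ge_min !lexx !orbT.
exists K => // n X n1 X0 H.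
have n1' : 1 <= n%:R :> R by rewrite ler1n.
have n0 : 0 < n%:R :> R by rewrite (lt_le_trans ltr01).
set u := n%:R `^ 3%:R^-1; have u0 : 0 < u by exact: powR_gt0.
have [big|small] := leP 3%:R^-1 (2 * beta - 1).
  have : u <= n%:R `^ (2 * beta - 1) by exact: ler_powR.
  set v := _ `^ _ => uv.
  have : K * u <= b * v by rewrite ler_pM // ltW.
  have : 0 <= a * X by rewrite mulr_ge0 // ltW.
  by lra.
have uv : u <= n%:R `^ (1 - beta).
  by apply: ler_powR => //; lra.
have {H}H : c * u <= 4 * X + 5 by apply: le_trans H; rewrite ler_wpM2l // ltW.
(* From 10 on, the additive 5 takes at most half of [c * u], hence [X >= c * u / 8]. *)
have [cu|cu] := leP 10 (c * u).
  have : K * u <= a * c / 8 * u by rewrite ler_wpM2r // ltW.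
  have : a * (c * u / 8) <= a * X by rewrite ler_wpM2l; lra.
  have : 0 <= b * n%:R `^ (2 * beta - 1) by rewrite mulr_ge0 ?powR_ge0 // ltW.
  by lra.
have u3 : u ^+ 3 = n%:R.
  by rewrite /u -powR_mulrn ?powR_ge0 // -powRrM mulVf ?pnatr_eq0 // powRr1 // ltW.
have : n%:R^-1 <= n%:R `^ (2 * beta - 1).
  by rewrite -(powR_inv1 (ltW n0)); apply: ler_powR => //; lra.
move=> low.
(* Below 10, [u] is bounded, so [u] is at most a constant times the inverse of [u ^+ 3 = n], and
   [beta > 0] bounds that inverse by the power of [n] in the second term. *)
have cu1 : (c / 10 * u) ^+ 4 <= 1 by rewrite exprn_ile1 //; nra.
have : b * (c / 10) ^+ 4 * u <= b * (u ^+ 3)^-1.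
  rewrite -mulrA ler_pM2l // -(ler_pM2r (exprn_gt0 3 u0)) mulVf; last first.
    by rewrite gt_eqF ?exprn_gt0.
  by rewrite -mulrA -exprS -exprMn.
have : K * u <= b * (c / 10) ^+ 4 * u by rewrite ler_wpM2r // ltW.
have : 0 <= a * X by rewrite mulr_ge0 // ltW.
have : b * (u ^+ 3)^-1 <= b * n%:R `^ (2 * beta - 1).
  by rewrite ler_pM2l // u3.
by lra.
Qed.

Lemma expect_ge0E (R : realType) (S : countType) (pi : S -> R) (h : S -> R) :
  (forall x, 0 <= h x) -> expect pi h = esp pi h.
Proof.
move=> h0; rewrite /expect [X in (_ - X)%E]esum1 ?sube0 => [|x _].
  by apply: eq_esum => x _; rewrite max_l.
by rewrite max_r ?mulr0 // oppr_le0.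
Qed.

Lemma expect_esp (R : realType) (S : countType) (pi : S -> R) (h : S -> R) :
  expect pi h = (esp pi (fun x => Num.max (h x) 0)%R
                 - esp pi (fun x => Num.max (- h x) 0)%R)%E.
Proof. by []. Qed.

Section ProfitLoss.
Variables (R : realType) (N M : finType) (E : {set N * M}).
Variables (DF : M -> set R) (DG : N -> set R) (F : M -> R -> R) (G : N -> R -> R).
Hypotheses (hDF : forall j, rate_range (DF j)) (hDG : forall i, rate_range (DG i)).
Hypotheses (hF : forall j, demand_curve (DF j) (F j)).
Hypotheses (hG : forall i, supply_curve (DG i) (G i)).
Variables (lam : M -> R) (mu : N -> R) (chi : N -> M -> R).
Hypothesis hopt : fluid_optimal E DF DG F G lam mu chi.
Local Notation xs := (pack lam mu).
Local Notation range := (pack DF DG).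

Variables (beta : R) (eta : nat) (Y : state N M -> matching N M).
Variables (C : set (state N M)) (pi : state N M -> R).
Hypotheses (eta1 : (1 <= eta)%N) (hY : matching_policy E Y).
Hypothesis hbeta : 0 < beta < 1.
Variables (rate d : M + N -> state N M -> R).
Hypothesis rateE : forall a q, rate a q = eta%:R * xs a + d a q * eta%:R `^ beta.
Hypothesis rate_in : forall a q, range a (rate a q / eta%:R).
Variable B : R.
Hypothesis dB : forall q, \sum_a `|d a q| <= B.
Hypothesis st : stationary_on (generator rate Y) C pi.

Let pi0 q : 0 <= pi q. Proof. by case: st. Qed.
Let pi1 : \esum_(q in setT) (pi q)%:E = 1%E. Proof. by case: st. Qed.
Let eta0 : 0 < eta%:R :> R. Proof. by rewrite ltr0n. Qed.
Let eta1R : 1 <= eta%:R :> R. Proof. by rewrite ler1n. Qed.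

Definition scaled_profit (q : state N M) : R :=
  fluid_profit (fun j => scaled_curve eta (F j)) (fun i => scaled_curve eta (G i))
    (fun j => rate (inl j) q) (fun i => rate (inr i) q).

Lemma scaled_profitE q :
  scaled_profit q = eta%:R * \sum_a gain F G a (rate a q / eta%:R).
Proof.
rewrite /scaled_profit fluid_profitE mulr_sumr; apply: eq_bigr => -[j|i] _ /=.
  by rewrite /scaled_curve mulrA [_ * (_ / _)]mulrC divfK // gt_eqF.
by rewrite /scaled_curve mulrN mulrA [_ * (_ / _)]mulrC divfK // gt_eqF.
Qed.

Lemma d_le a q : `|d a q| <= B.
Proof.
by apply: le_trans (dB q); rewrite (bigD1 a) //= lerDl sumr_ge0.
Qed.

Lemma B_ge0 : 0 <= B.
Proof. by apply: le_trans (dB [ffun=> 0%N]); exact: sumr_ge0. Qed.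

Lemma powR_le_eta : eta%:R `^ beta <= eta%:R.
Proof. by case/andP: hbeta => _ /ltW b1; exact: ler1_powR. Qed.

Lemma rate_ge0 a q : 0 <= rate a q.
Proof.
have : 0 <= rate a q / eta%:R.
  by case: (a) (rate_in a q) => [j|i] /=;
    [case: (hDF j) => _ + _|case: (hDG i) => _ + _]; exact.
by rewrite pmulr_lge0 // invr_gt0.
Qed.

Local Notation Lmax := (eta%:R * \sum_a xs a + eta%:R * B).

Lemma total_le q : \sum_a rate a q <= Lmax.
Proof.
under eq_bigr do rewrite rateE.
rewrite big_split /= -mulr_sumr -mulr_suml lerD2l mulrC.
apply: (@le_trans _ _ (eta%:R `^ beta * B)); last first.
  by rewrite ler_wpM2r ?B_ge0 // powR_le_eta.
rewrite ler_wpM2l ?powR_ge0 //; apply: le_trans (dB q).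
by apply: ler_sum => a _; exact: ler_norm.
Qed.

Section Gap.
Variables (r' : M + N -> R -> R) (k : R).
Hypothesis k0 : 0 < k.
Hypothesis dr' : forall a, deriv_on (range a) (gain F G a) (r' a).
Hypothesis gap : forall x : M + N -> R, (forall a, range a (x a)) ->
  (forall a, `|x a - xs a| <= B) ->
  \sum_a gain F G a (x a) <= fluid_profit F G lam mu
    + \sum_a r' a (xs a) * (x a - xs a) - k * \sum_a (x a - xs a) ^+ 2.

Lemma rate_deviation a q :
  rate a q / eta%:R - xs a = d a q * eta%:R `^ (beta - 1).
Proof.
rewrite rateE powRB ?powRr1 ?ltW //; last by rewrite (gt_eqF eta0) implybT.
by rewrite mulrDl mulrAC divff ?gt_eqF // mul1r addrC addKr mulrA.
Qed.

(** This is [gap] at the rates divided by [eta], whose distance to the optimum is [|d a q|] times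
    eta^(beta - 1), hence at most [B]. Multiplying the squared distance by [eta] produces the
    exponent [2 * beta - 1]. *)
Lemma scaled_profit_le q : scaled_profit q <= eta%:R * fluid_profit F G lam mu
  + \sum_a r' a (xs a) * (rate a q - eta%:R * xs a)
  - k * eta%:R `^ (2 * beta - 1) * \sum_a d a q ^+ 2.
Proof.
rewrite scaled_profitE.
have dev a : `|rate a q / eta%:R - xs a| <= B.
  rewrite rate_deviation normrM (ger0_norm (powR_ge0 _ _)).
  rewrite -[leRHS]mulr1 ler_pM ?powR_ge0 ?d_le //.
  by rewrite -[leRHS](powRr0 eta%:R) ler_powR //; case/andP: hbeta; lra.
have := gap (fun a => rate_in a q) dev.
rewrite -(ler_pM2l eta0) => /le_trans; apply.
rewrite le_eqVlt; apply/orP; left; apply/eqP.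
rewrite mulrBr mulrDr; congr (_ + _ - _).
  rewrite mulr_sumr; apply: eq_bigr => a _.
  by rewrite mulrCA; congr (_ * _); rewrite mulrBr mulrC divfK // gt_eqF.
rewrite mulrCA -mulrA; congr (_ * _); rewrite !mulr_sumr; apply: eq_bigr => a _.
rewrite rate_deviation exprMn mulrCA [RHS]mulrC; congr (_ * _).
rewrite -powR_mulrn ?powR_ge0 // -powRrM -[X in X * _]powRr1 ?ltW //.
rewrite -powRD; last by rewrite (gt_eqF eta0) implybT.
by congr (_ `^ _); lra.
Qed.

Hypothesis hq : forall a, integ pi (fun q => (q a)%:R).

Let ratei a : integ pi (rate a).
Proof. exact: (integ_rate rate_ge0 st total_le). Qed.

(** The matching chosen in [q] is carried out at the next arrival, hence the weight by the total
    rate: this is the long-run match rate of the pair, per unit of [eta]. *)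
Definition mean_flow (i : N) (j : M) : R :=
  Ex pi (fun q => (\sum_a rate a q) * (Y q (i, j))%:R) / eta%:R.

Lemma integ_flow i j :
  integ pi (fun q => (\sum_a rate a q) * (Y q (i, j))%:R).
Proof.
apply: (integ_total rate_ge0 st total_le).
apply: integ_dom (hq (inl j)) => // q; rewrite !normr_nat ler_nat.
have [/(_ (inl j)) /= le_q _] := hY q; apply: leq_trans le_q.
by rewrite (bigD1 i) //= leq_addr.
Qed.

(** The flow equations are [flow_balance] summed over partners; the mean rates remain in the
    feasible ranges because these are intervals. *)
Lemma mean_flow_feasible : fluid_feasible E DF DG
  (fun j => Ex pi (rate (inl j)) / eta%:R)
  (fun i => Ex pi (rate (inr i)) / eta%:R) mean_flow.
Proof.
have fb b := flow_balance hY rate_ge0 st total_le hq b.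
have meanE a : Ex pi (rate a) / eta%:R = Ex pi (fun q => rate a q / eta%:R).
  under [RHS]eq_Ex do rewrite mulrC.
  by rewrite (ExZ pi0 _ (ratei a)) mulrC.
have mean_in a : range a (Ex pi (rate a) / eta%:R).
  rewrite meanE; apply: Ex_in_interval => //; first exact: range_interval.
  have := integZ pi0 eta%:R^-1 (ratei a).
  by congr integ; apply/funext => q; rewrite mulrC.
split.
- move=> j; rewrite -fb /mean_flow -mulr_suml; congr (_ / _).
  rewrite -(Ex_sum pi0 pi1 (fun i => integ_flow i j)).
  by apply: eq_Ex => q; rewrite -mulr_sumr /= natr_sum.
- move=> i; rewrite -fb /mean_flow -mulr_suml; congr (_ / _).
  rewrite -(Ex_sum pi0 pi1 (integ_flow i)).
  by apply: eq_Ex => q; rewrite -mulr_sumr /= natr_sum.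
- move=> i j _; rewrite mulr_ge0 ?invr_ge0 //; apply: Ex_ge0 (integ_flow i j) => //.
  by move=> q; rewrite mulr_ge0 // sumr_ge0 // => a _; exact: rate_ge0.
- move=> i j Eij; rewrite /mean_flow (@eq_Ex _ _ pi _ (fun=> 0)).
    by rewrite Ex_cst ?mul0r.
  by move=> q; have [_ /(_ _ Eij) ->] := hY q; rewrite mulr0.
- by split=> [j|i]; [exact: mean_in (inl j)|exact: mean_in (inr i)].
Qed.

Lemma integ_deviation : integ pi (fun q => \sum_a d a q ^+ 2).
Proof.
apply: (integ_sum pi0 pi1) => a.
apply: (@integ_bounded _ _ _ pi0 pi1 _ (B ^+ 2)) => q.
by rewrite normrX lerXn2r ?nnegrE ?B_ge0 // d_le.
Qed.

Let lin a : integ pi (fun q => r' a (xs a) * (rate a q - eta%:R * xs a)).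
Proof. by apply/(integZ pi0)/(integB pi0) => //; exact: integ_cst. Qed.

(** In mean, the linear term is [eta] times the directional derivative at the optimum towards the
    feasible mean rates, so [first_order_condition] makes it nonpositive and only the quadratic loss
    is left. *)
Lemma mean_scaled_profit_le : integ pi scaled_profit ->
  Ex pi scaled_profit <= eta%:R * fluid_profit F G lam mu
    - k * eta%:R `^ (2 * beta - 1) * Ex pi (fun q => \sum_a d a q ^+ 2).
Proof.
move=> Pi; have si := integ_sum pi0 pi1 lin.
have gi := integ_cst pi0 pi1 (eta%:R * fluid_profit F G lam mu).
have gsi := integD pi0 gi si.
have di := integZ pi0 (k * eta%:R `^ (2 * beta - 1)) integ_deviation.
have := le_Ex pi0 Pi (integB pi0 gsi di) scaled_profit_le.
rewrite (ExB pi0 gsi di) (ExD pi0 gi si) (Ex_cst pi0 pi1).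
rewrite (ExZ pi0 _ integ_deviation) (Ex_sum pi0 pi1 lin).
suff : \sum_a Ex pi (fun q => r' a (xs a) * (rate a q - eta%:R * xs a)) <= 0.
  by lra.
have := first_order_condition hDF hDG hopt dr' mean_flow_feasible.
rewrite -(ler_pM2l eta0) mulr0 mulr_sumr; congr (_ <= _).
apply: eq_bigr => a _.
have ci := integ_cst pi0 pi1 (eta%:R * xs a).
rewrite (ExZ pi0 _ (integB pi0 (ratei a) ci)) (ExB pi0 (ratei a) ci).
rewrite (Ex_cst pi0 pi1) mulrCA mulrBr; congr (_ * (_ - _)).
by case: (a) => b /=; rewrite mulrC divfK // gt_eqF.
Qed.

(** The deviations are bounded and the quadratic term only lowers the profit, so the profit is
    bounded above and integrability depends on its negative part alone. *)
Lemma scaled_profit_integ :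
  (esp pi (fun q => Num.max (- scaled_profit q) 0)%R < +oo)%E ->
  integ pi scaled_profit.
Proof.
move=> neg; pose b := `|eta%:R * fluid_profit F G lam mu|
  + \sum_a `|r' a (xs a)| * (eta%:R * B).
have b0 : 0 <= b.
  by rewrite addr_ge0 // sumr_ge0 // => a _; rewrite !mulr_ge0 ?B_ge0.
have le_b q : scaled_profit q <= b.
  apply: le_trans (scaled_profit_le q) _.
  apply: (@le_trans _ _ (eta%:R * fluid_profit F G lam mu
    + \sum_a r' a (xs a) * (rate a q - eta%:R * xs a))).
    by rewrite gerBl !mulr_ge0 ?powR_ge0 ?(ltW k0) // sumr_ge0 // => a _;
      rewrite sqr_ge0.
  apply: lerD; first exact: ler_norm.
  apply: ler_sum => a _; apply: le_trans (ler_norm _) _.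
  rewrite normrM ler_wpM2l // rateE addrAC subrr add0r normrM mulrC.
  by rewrite ler_pM ?d_le // ger0_norm ?powR_ge0 // powR_le_eta.
apply: (@integ_le _ _ _ pi0 _ (fun q => b + Num.max (- scaled_profit q) 0)).
  move=> q; have := le_b q; set p := scaled_profit q => pb.
  have [p0|p0] := leP 0 p.
    by rewrite ger0_norm // (le_trans pb) // lerDl le_max lexx orbT.
  by rewrite ltr0_norm // max_l ?lerDr // oppr_ge0 ltW.
rewrite espD // => [|q]; last by rewrite le_max lexx orbT.
by rewrite lte_add_pinfty // (integ_esp (fun=> b0)) //; exact: integ_cst.
Qed.
End Gap.

End ProfitLoss.

(** * Lower bounds for the mean imbalance and the mean rate deviation *)

Section DeviationLowerBound.
Variables (R : realType) (N M : finType) (E : {set N * M}).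
Variables (Y : state N M -> matching N M) (C : set (state N M)).
Variables (pi : state N M -> R) (rate d : M + N -> state N M -> R).
Variables (xs : M + N -> R) (beta : R) (eta : nat) (Lmax B : R).
Hypotheses (hY : matching_policy E Y) (eta1 : (1 <= eta)%N).
Hypothesis hbeta : 0 < beta < 1.
Hypothesis rate0 : forall a q, 0 <= rate a q.
Hypothesis st : stationary_on (generator rate Y) C pi.
Hypothesis rate_le : forall q, \sum_a rate a q <= Lmax.
Hypothesis hq : forall a, integ pi (fun q => (q a)%:R).
Hypothesis rateE : forall a q, rate a q = eta%:R * xs a + d a q * eta%:R `^ beta.
Hypothesis dB : forall q, \sum_a `|d a q| <= B.
Hypothesis xs_balance : \sum_a side R a * xs a = 0.
Hypothesis xs0 : forall a, 0 <= xs a.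

Let pi0 q : 0 <= pi q. Proof. by case: st. Qed.
Let pi1 : \esum_(q in setT) (pi q)%:E = 1%E. Proof. by case: st. Qed.
Let eta0 : 0 < eta%:R :> R. Proof. by rewrite ltr0n. Qed.
Let eta1R : 1 <= eta%:R :> R. Proof. by rewrite ler1n. Qed.

Local Notation S := (fun q => \sum_a `|d a q|).
Local Notation cx := (\sum_a xs a).
Local Notation W := (@imbalance R N M).

Lemma integ_abs_deviation : integ pi S.
Proof.
apply: (@integ_bounded _ _ _ pi0 pi1 _ B) => q.
by rewrite ger0_norm ?dB // sumr_ge0.
Qed.

(** The fluid rates are balanced and contribute no drift, so [imbalance_spread] applies with [sigma]
    of order eta^beta; that factor is then divided out. *)
Lemma deviation_spread (t : R) : 0 <= t ->
  cx * eta%:R `^ (1 - beta) * Ex pi (fun q => (`|W q| <= t)%R%:R)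
  <= (2 * t + 3) * Ex pi S.
Proof.
move=> t0; have p0 : 0 < eta%:R `^ beta by rewrite powR_gt0.
have drift q : `|\sum_a side R a * rate a q| <= eta%:R `^ beta * S q.
  have -> : \sum_a side R a * rate a q =
      eta%:R `^ beta * \sum_a side R a * d a q.
    under eq_bigr do rewrite rateE mulrDr mulrCA [d _ _ * _]mulrC [X in _ + X]mulrCA.
    by rewrite big_split /= -!mulr_sumr xs_balance mulr0 add0r.
  rewrite normrM (ger0_norm (ltW p0)) ler_wpM2l ?powR_ge0 //.
  apply: le_trans (ler_norm_sum _ _ _) _; apply: ler_sum => a _.
  by rewrite normrM; case: a => a; rewrite /= ?normrN normr1 mul1r.
have total q : eta%:R * cx - eta%:R `^ beta * S q <= \sum_a rate a q.
  rewrite !mulr_sumr -sumrB; apply: ler_sum => a _.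
  rewrite rateE lerD2l [d a q * _]mulrC -mulrN ler_wpM2l ?powR_ge0 //.
  by rewrite lerNl -normrN ler_norm.
have sigma0 q : 0 <= eta%:R `^ beta * S q by rewrite mulr_ge0 ?powR_ge0 ?sumr_ge0.
have sigmai := integZ pi0 (eta%:R `^ beta) integ_abs_deviation.
have := imbalance_spread hY rate0 st rate_le hq sigma0 sigmai drift total t0.
rewrite (ExZ pi0 _ integ_abs_deviation) [(2 * t + 3) * _]mulrCA.
move=> H; rewrite -(ler_pM2l p0); move: H.
have e : eta%:R `^ beta * eta%:R `^ (1 - beta) = eta%:R :> R.
  rewrite -powRD; last by rewrite (gt_eqF eta0) implybT.
  by rewrite addrCA subrr addr0 powRr1 // ltW.
suff -> : forall P, eta%:R `^ beta * (cx * eta%:R `^ (1 - beta) * P)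
    = eta%:R * cx * P by [].
by move=> P; rewrite -[in RHS]e; ring.
Qed.

(** Either the imbalance is at most [t], an event whose probability [deviation_spread] bounds by the
    mean of [S], or some queue is long and [S >= delta]. Eliminating the probability leaves a bound
    free of [eta]. *)
Lemma mean_deviation_ge (alpha kappa delta : R) :
  alpha + beta <= 1 -> 0 <= kappa -> 0 <= delta ->
  (forall (q : state N M) a, kappa < (q a)%:R / eta%:R `^ alpha -> delta <= S q) ->
  delta * cx <= (cx + delta * (2 * (#|{: M + N}|%:R * kappa) + 3)) * Ex pi S.
Proof.
move=> ab kappa0 delta0 large; set n := #|_|%:R.
set p := eta%:R `^ (1 - beta); have p1 : 1 <= p.
  rewrite -(powRr0 eta%:R) ler_powR //; case/andP: hbeta; lra.
(* If every one of the [n] queues is at most [kappa * p], the imbalance is at most [t]. Since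
   [alpha <= 1 - beta], a queue above [kappa * p] meets the threshold of [large]. *)
pose t := n * kappa * p.
have t0 : 0 <= t by rewrite !mulr_ge0 ?ler0n // (le_trans ler01).
have spread := deviation_spread t0.
set I := fun q => (`|W q| <= t)%R%:R : R.
have pw q : delta - delta * I q <= S q.
  rewrite /I; have [_|Wt] := leP `|W q| t; first by rewrite mulr1 subrr sumr_ge0.
  rewrite mulr0 subr0.
  have [[a qa]|nq] := pselect (exists a, kappa * p < (q a)%:R).
    apply: (large q a); rewrite ltr_pdivlMr ?powR_gt0 //; apply: le_lt_trans qa.
    by rewrite ler_wpM2l // ler_powR //; lra.
  exfalso; move: Wt; apply/negP; rewrite -leNgt.
  apply: le_trans (imbalance_le R q) _.
  rewrite /t /n -mulrA mulr_natl -sumr_const; apply: ler_sum => a _.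
  by rewrite leNgt; apply/negP => qa; apply: nq; exists a.
have Ii := integ_indicator st (fun q => `|W q| <= t).
have dIi := integZ pi0 delta Ii; have di := integ_cst pi0 pi1 delta.
have := le_Ex pi0 (integB pi0 di dIi) integ_abs_deviation pw.
rewrite (ExB pi0 di dIi) (Ex_cst pi0 pi1) (ExZ pi0 _ Ii).
move: spread; rewrite -/I -/p.
set P := Ex pi I; set D := Ex pi S => spread H.
have cx0 : 0 <= cx by exact: sumr_ge0.
have D0 : 0 <= D by apply: Ex_ge0 integ_abs_deviation => // q; rewrite sumr_ge0.
have PD : cx * P <= (2 * (n * kappa) + 3) * D.
  have p0 : 0 < p by apply: lt_le_trans p1.
  rewrite -(ler_pM2r p0) mulrAC; apply: le_trans spread _.
  rewrite mulrAC ler_wpM2r // /t.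
  by move: p1; lra.
have : cx * (delta - delta * P) <= cx * D by rewrite ler_wpM2l.
have : delta * (cx * P) <= delta * ((2 * (n * kappa) + 3) * D).
  by rewrite ler_wpM2l.
by lra.
Qed.

(** With [t = 2 * X + 1], Markov's inequality gives [|W| <= t] probability at least 1/2, while [S]
    has mean at most [B]; then [2 * t + 3 = 4 * X + 5]. The added 1 keeps [t] positive when
    [X = 0]. *)
Lemma mean_imbalance_ge : 0 < B ->
  cx / (2 * B) * eta%:R `^ (1 - beta) <= 4 * Ex pi (fun q => `|W q|) + 5.
Proof.
move=> B0; set X := Ex pi _; set p := eta%:R `^ _.
have p0 : 0 <= p by exact: powR_ge0.
have Wi : integ pi (fun q => `|W q|).
  apply: integ_dom (integ_imbalance st hq) => // q.
  by rewrite normr_id.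
have X0 : 0 <= X by exact: Ex_ge0.
pose t := 2 * X + 1; have t0 : 0 < t by rewrite /t; lra.
have spread := deviation_spread (ltW t0).
have Ii := integ_indicator st (fun q => `|W q| <= t).
have pw q : 1 - t^-1 * `|W q| <= (`|W q| <= t)%R%:R.
  have [_|/ltW Wt] := leP `|W q| t; last by rewrite subr_le0 ler_pdivlMl ?mulr1.
  by rewrite gerBl mulr_ge0 // invr_ge0 ltW.
have half : 2^-1 <= Ex pi (fun q => (`|W q| <= t)%R%:R).
  have tWi := integZ pi0 t^-1 Wi; have i1 := integ_cst pi0 pi1 1.
  have := le_Ex pi0 (integB pi0 i1 tWi) Ii pw.
  rewrite (ExB pi0 i1 tWi) (Ex_cst pi0 pi1) (ExZ pi0 _ Wi) -/X; apply: le_trans.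
  have : t^-1 * X <= 2^-1 by rewrite ler_pdivrMl // /t; lra.
  by lra.
have SB : Ex pi S <= B.
  rewrite -[leRHS](Ex_cst pi0 pi1); apply: le_Ex => //.
    exact: integ_abs_deviation.
  exact: integ_cst.
have cx0 : 0 <= cx by exact: sumr_ge0.
have : cx * p * 2^-1 <= (2 * t + 3) * B.
  apply: le_trans (_ : cx * p * Ex pi (fun q => (`|W q| <= t)%R%:R) <= _).
    by rewrite ler_wpM2l // mulr_ge0.
  by apply: le_trans spread _; rewrite ler_wpM2l //; lra.
move=> H; rewrite mulrAC ler_pdivrMr ?mulr_gt0 //.
by move: H; rewrite /t; lra.
Qed.

(** Cauchy-Schwarz through the tangent line of the square at [th = c1 / n], which is linear in [S]
    and can be averaged directly. *)
Lemma mean_square_deviation_ge (c1 : R) : 0 <= c1 -> (0 < #|{: M + N}|)%N ->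
  c1 <= Ex pi S ->
  c1 ^+ 2 / #|{: M + N}|%:R <= Ex pi (fun q => \sum_a d a q ^+ 2).
Proof.
move=> c10 n0 cS; set n := #|_|%:R; have n0R : 0 < n :> R by rewrite ltr0n.
pose th := c1 / n; have th0 : 0 <= th by rewrite divr_ge0 // ltW.
have pw q : 2 * th * S q - n * th ^+ 2 <= \sum_a d a q ^+ 2.
  have -> : n * th ^+ 2 = \sum_(a : M + N) th ^+ 2.
    by rewrite sumr_const mulr_natl.
  rewrite mulr_sumr -sumrB; apply: ler_sum => a _.
  have := sqr_ge0 (`|d a q| - th); rewrite -[d a q ^+ 2]real_normK ?num_real //.
  by lra.
have Si := integ_abs_deviation.
have zi := integZ pi0 (2 * th) Si; have ci := integ_cst pi0 pi1 (n * th ^+ 2).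
have si : integ pi (fun q => \sum_a d a q ^+ 2).
  apply: (@integ_bounded _ _ _ pi0 pi1 _ (\sum_(a : M + N) B ^+ 2)) => q.
  rewrite ger0_norm ?sumr_ge0 // => [|a _]; last exact: sqr_ge0.
  apply: ler_sum => a _; rewrite -[d a q ^+ 2]real_normK ?num_real //.
  have dB' : `|d a q| <= B.
    by apply: le_trans (dB q); rewrite (bigD1 a) //= lerDl sumr_ge0.
  by rewrite lerXn2r // nnegrE (le_trans _ dB').
have := le_Ex pi0 (integB pi0 zi ci) si pw.
rewrite (ExB pi0 zi ci) (Ex_cst pi0 pi1) (ExZ pi0 _ Si); apply: le_trans.
have -> : c1 ^+ 2 / n = 2 * th * c1 - n * th ^+ 2.
  by rewrite /th; field; rewrite gt_eqF.
by rewrite lerD2r ler_wpM2l // mulr_ge0.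
Qed.
End DeviationLowerBound.

(** * Choice of constants uniform in [eta], and combination of waiting cost and pricing loss *)

Theorem theorem3 (R : realType) (N M : finType) (E : {set N * M})
  (DF : M -> set R) (DG : N -> set R) (F : M -> R -> R) (G : N -> R -> R)
  (s : M + N -> R)
  (lam : M -> R) (mu : N -> R) (chi : N -> M -> R)
  (f : M -> {ffun M + N -> R} -> R) (g : N -> {ffun M + N -> R} -> R)
  (alpha beta : R) (Gamma : M -> R) (Psi : N -> R) (kappa delta : R)
  (hDF : forall j, rate_range (DF j)) (hDG : forall i, rate_range (DG i))
  (hF : forall j, demand_curve (DF j) (F j))
  (hG : forall i, supply_curve (DG i) (G i))
  (hs : forall a, 0 < s a)
  (hopt : fluid_optimal E DF DG F G lam mu chi)
  (hlam : forall j, 0 < lam j) (hmu : forall i, 0 < mu i)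
  (halpha : 0 <= alpha <= 1) (hbeta : 0 < beta < 1)
  (* the prescribed rates are feasible in every system *)
  (hratesF : forall (eta : nat) (q : state N M) (j : M), (1 <= eta)%N ->
     DF j (pricing lam mu f g alpha beta eta (inl j) q / eta%:R))
  (hratesG : forall (eta : nat) (q : state N M) (i : N), (1 <= eta)%N ->
     DG i (pricing lam mu f g alpha beta eta (inr i) q / eta%:R))
  (* (a) *)
  (hGamma : forall j, 0 <= Gamma j) (hPsi : forall i, 0 <= Psi i)
  (hf : forall (eta : nat) (q : state N M) (j : M), (1 <= eta)%N ->
     `|f j (rescaled eta alpha q)| <= Gamma j)
  (hg : forall (eta : nat) (q : state N M) (i : N), (1 <= eta)%N ->
     `|g i (rescaled eta alpha q)| <= Psi i)
  (* (b) *)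
  (hab : 0 < alpha + beta <= 1)
  (* (c) *)
  (hkappa : 0 < kappa) (hdelta : 0 < delta)
  (hcF : forall (eta : nat) (q : state N M) (j : M), (1 <= eta)%N ->
     kappa < rescaled eta alpha q (inl j) ->
     f j (rescaled eta alpha q) < - delta \/
     exists i, (i, j) \in E /\ delta < g i (rescaled eta alpha q))
  (hcG : forall (eta : nat) (q : state N M) (i : N), (1 <= eta)%N ->
     kappa < rescaled eta alpha q (inr i) ->
     g i (rescaled eta alpha q) < - delta \/
     exists j, (i, j) \in E /\ delta < f j (rescaled eta alpha q)) :
  exists K : R, 0 < K /\
    forall (eta : nat) (Y : state N M -> matching N M)
           (C : set (state N M)) (pi : state N M -> R),
      (1 <= eta)%N ->
      matching_policy E Y ->
      let rate := pricing lam mu f g alpha beta eta in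
      let Q := generator rate Y in
      stable_class Q C ->
      stationary_on Q C pi ->
      ((K * eta%:R `^ (3%:R^-1))%:E
         <= profit_loss F G s (fluid_profit F G lam mu) eta rate pi)%E.
Proof.
(* Without customer types no class is stable and any [K] works; otherwise [cx] and [n] are
   positive. *)
have [[j0 _]|noM] := pselect (exists j : M, True); last first.
  by exists 1; split=> // eta Y C pi _ _ rate Q [_ [j _]]; case: noM; exists j.
pose xs := pack lam mu; pose cx := \sum_a xs a.
have xs0 a : 0 < xs a by case: a.
have cx0 : 0 < cx.
  by rewrite /cx (bigD1 (inl j0)) //= ltr_pwDl ?xs0 // sumr_ge0 // => a _; exact: ltW.
have n0 : (0 < #|{: M + N}|)%N by apply/card_gt0P; exists (inl j0).
pose n : R := #|{: M + N}|%:R.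
have n0R : 0 < n by rewrite ltr0n.
pose bound := pack Gamma Psi; pose B := 1 + \sum_a bound a.
have B0 : 0 < B.
  rewrite ltr_pwDl // sumr_ge0 // => -[j|i] _.
    exact: hGamma.
  exact: hPsi.
have [r' [k [k0 dr' gap]]] := quadratic_gap hDF hDG hF hG hopt B0.
have [smin smin0 le_s] : exists2 x, 0 < x & forall a, x <= s a.
  apply: finite_positive_bound => [a x y _ yx|a]; first exact: le_trans.
  by exists (s a).
(* [c1] is the bound on the mean of [S] obtained by solving [mean_deviation_ge]. Like [B], [k] and
   [smin], it is fixed before [eta], the policy and [pi]. *)
pose D := cx + delta * (2 * (n * kappa) + 3).
have D0 : 0 < D.
  by rewrite addr_gt0 // mulr_gt0 // ltr_wpDl // !mulr_ge0 // ltW.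
pose c1 := delta * cx / D; have c10 : 0 < c1 by rewrite divr_gt0 // mulr_gt0.
pose b := k * (c1 ^+ 2 / n).
have b0 : 0 < b by rewrite mulr_gt0 // divr_gt0 // exprn_gt0.
have c20 : 0 < cx / (2 * B) by rewrite divr_gt0 // mulr_gt0.
have [K K0 HK] := powR_tradeoff smin0 b0 c20 hbeta.
exists K; split => // eta Y C pi eta1 hY rate Q _ st.
have [pi0 _ pi1 _] := st.
pose d a q := pack f g a (rescaled eta alpha q).
have rateE a q : rate a q = eta%:R * xs a + d a q * eta%:R `^ beta by case: a.
have rate_in a q : pack DF DG a (rate a q / eta%:R).
  by case: a => [j|i]; [exact: hratesF|exact: hratesG].
have dB q : \sum_a `|d a q| <= B.
  apply: (@le_trans _ _ (\sum_a bound a)); last by rewrite lerDr.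
  by apply: ler_sum => -[j|i] _; [exact: hf|exact: hg].
have balance : \sum_a side R a * xs a = 0.
  case: hopt => -[lE mE _ _ _] _; rewrite big_sumType /=.
  under eq_bigr do rewrite mul1r lE; under [X in _ + X]eq_bigr do rewrite mulN1r mE.
  by rewrite sumrN exchange_big subrr.
have large (q : state N M) a : kappa < (q a)%:R / eta%:R `^ alpha ->
    delta <= \sum_a `|d a q|.
  have le_dev e : `|d e q| <= \sum_a `|d a q|.
    by rewrite (bigD1 e) //= lerDl sumr_ge0.
  have pos e : delta < d e q -> delta <= \sum_a `|d a q|.
    by move=> H; apply: le_trans (le_dev e); apply: le_trans (ler_norm _); exact: ltW.
  have neg e : d e q < - delta -> delta <= \sum_a `|d a q|.
    move=> H; apply: le_trans (le_dev e); rewrite -normrN.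
    by apply: le_trans (ler_norm _); rewrite lerNr ltW.
  move=> qa; have {}qa : kappa < rescaled eta alpha q a by rewrite ffunE.
  case: a qa => [j /(hcF _ _ _ eta1)|i /(hcG _ _ _ eta1)] [|[e [_]]].
  - exact: (neg (inl j)).
  - exact: (pos (inr e)).
  - exact: (neg (inr i)).
  - exact: (pos (inl e)).
have rate0 := rate_ge0 hDF hDG eta1 rate_in.
have rateL := total_le eta1 hbeta rateE dB.
rewrite /profit_loss -/(scaled_profit F G eta rate).
(* An infinite mean queue length makes the total waiting cost, hence the loss, equal to [+oo]. *)
have [hq|nq] := pselect (forall a, integ pi (fun q : state N M => (q a)%:R)); last first.
  have [a qa] : exists a, esp pi (fun q : state N M => (q a)%:R) = +oo%E.
    apply: contrapT => H; apply: nq => a.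
    rewrite /integ (eq_esp _ (fun q : state N M => normr_nat R (q a))) ltey.
    by apply/eqP => qa; apply: H; exists a.
  have term0 c : (0 <= (s c)%:E * expect pi (fun q : state N M => (q c)%:R))%E.
    rewrite expect_ge0E //; apply: mule_ge0; first by rewrite lee_fin ltW.
    exact: esp_ge0.
  have -> : (\sum_c (s c)%:E * expect pi (fun q : state N M => (q c)%:R) = +oo)%E.
    rewrite (bigD1 a) //= [X in (_ * X)%E]expect_ge0E // qa gt0_muley ?lte_fin //.
    rewrite addye // -ltNye; apply: (@lt_le_trans _ _ 0%E); first exact: ltNy0.
    by apply: sume_ge0 => c _; exact: term0.
  by rewrite addeNy addey // leey.
(* If the negative part of the profit has infinite mean, [expect] is [-oo] whatever the positive
   part is, and the loss is again [+oo]. *)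
have [fin|inf] := pselect
    (esp pi (fun q => Num.max (- scaled_profit F G eta rate q) 0)%R < +oo)%E; last first.
  rewrite expect_esp (_ : esp pi (fun q => Num.max (- _) 0) = +oo%E).
    by rewrite addeNy addNye addey // leey.
  by apply/eqP; rewrite -leye_eq leNgt; apply/negP.
have Pi := scaled_profit_integ eta1 hbeta rateE rate_in dB st k0 gap fin.
have profit_le := mean_scaled_profit_le hDF hDG hopt eta1 hY hbeta rateE rate_in dB st
  dr' gap hq Pi.
have S1 : c1 <= Ex pi (fun q => \sum_a `|d a q|).
  rewrite ler_pdivrMr // [leRHS]mulrC.
  case/andP: hab => _ ab.
  exact: (mean_deviation_ge hY eta1 hbeta rate0 st rateL hq rateE dB balance
    (fun a => ltW (xs0 a)) ab (ltW hkappa) (ltW hdelta) large).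
have S2 := mean_square_deviation_ge st dB (ltW c10) n0 S1.
have W1 := mean_imbalance_ge hY eta1 rate0 st rateL hq rateE dB balance
  (fun a => ltW (xs0 a)) B0.
set X := Ex pi (fun q => `|imbalance R q|) in W1.
have X0 : 0 <= X.
  apply: Ex_ge0 => //; apply: integ_dom (integ_imbalance st hq) => // q.
  by rewrite normr_id.
(* Each unit of [|imbalance|] is accounted for by a waiting agent, whose unit cost is at least
   [smin]. *)
have cost : smin * X <= \sum_a s a * Ex pi (fun q : state N M => (q a)%:R).
  have sumi := integ_sum pi0 pi1 hq.
  have XS : X <= \sum_a Ex pi (fun q : state N M => (q a)%:R).
    rewrite -(Ex_sum pi0 pi1 hq); apply: le_Ex sumi _ => //.
      by apply: integ_dom (integ_imbalance st hq) => // q; rewrite normr_id.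
    exact: imbalance_le.
  apply: (@le_trans _ _ (smin * \sum_a Ex pi (fun q : state N M => (q a)%:R))).
    by rewrite ler_wpM2l // ltW.
  rewrite mulr_sumr; apply: ler_sum => a _; rewrite ler_wpM2r //.
  exact: Ex_ge0 (hq a).
have quad : b * eta%:R `^ (2 * beta - 1) <=
    k * eta%:R `^ (2 * beta - 1) * Ex pi (fun q => \sum_a d a q ^+ 2).
  by rewrite /b mulrAC ler_wpM2l // mulr_ge0 ?powR_ge0 // ltW.
have := HK eta X eta1 X0 W1.
rewrite (expect_fin pi0 Pi); under eq_bigr do rewrite (expect_fin pi0 (hq _)) -EFinM.
rewrite sumEFin -!EFinB lee_fin; lra.
Qed.
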